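(* The Diophantine pair $\{1,3\}$ cannot be extended to a Diophantine quintuple in $\mathbb{Z}[\sqrt{-2}]$; that is, there do not exist $a,b,c\in\mathbb{Z}[\sqrt{-2}]$ such that $\{1,3,a,b,c\}$ is a Diophantine quintuple in $\mathbb{Z}[\sqrt{-2}]$.
   Context: Let $R$ be a commutative ring with unity $1$. A set $\{a_1,\ldots,a_m\}\subset R$ is a Diophantine $m$-tuple in $R$ if $a_i\neq 0$ for all $i$, $a_i\neq a_j$ for all $i\ne j$, and $a_ia_j+1$ is a square in $R$ for all $1\le i<j\le m$. A Diophantine pair is a Diophantine $2$-tuple and a Diophantine quintuple is a Diophantine $5$-tuple (so its five elements are nonzero and pairwise distinct). *)

(* Defs.v *)
From HB Require Import structures.
From mathcomp Require Import all_boot all_order all_algebra ring.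

Set Implicit Arguments.
Unset Strict Implicit.
Unset Printing Implicit Defensive.

Import GRing.Theory.
Local Open Scope ring_scope.

Definition is_square (R : comPzRingType) (x : R) : Prop := exists y : R, x = y ^+ 2.

(* The tuple enumerates the set {a_1, ..., a_m}. *)
Definition diophantine_tuple (R : comPzRingType) (m : nat) (a : m.-tuple R) : Prop :=
  [/\ forall i : 'I_m, tnth a i <> 0,
      forall i j : 'I_m, i <> j -> tnth a i <> tnth a j
    & forall i j : 'I_m, (i < j)%N -> is_square (tnth a i * tnth a j + 1)].

(* The ring Z[sqrt(-2)]: [ZsqrtN2 x y] stands for x + y * sqrt(-2). *)
Record zsqrtN2 : Type := ZsqrtN2 { rat_part : int; irr_part : int }.

Definition zsqrtN2_to_pair (z : zsqrtN2) : int * int := (rat_part z, irr_part z).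
Definition zsqrtN2_of_pair (p : int * int) : zsqrtN2 := ZsqrtN2 p.1 p.2.

Lemma zsqrtN2_to_pairK : cancel zsqrtN2_to_pair zsqrtN2_of_pair.
Proof. by case. Qed.

HB.instance Definition _ := Choice.copy zsqrtN2 (can_type zsqrtN2_to_pairK).

Definition zsqrtN2_zero : zsqrtN2 := ZsqrtN2 0 0.
Definition zsqrtN2_one : zsqrtN2 := ZsqrtN2 1 0.
Definition zsqrtN2_opp (u : zsqrtN2) : zsqrtN2 :=
  ZsqrtN2 (- rat_part u) (- irr_part u).
Definition zsqrtN2_add (u v : zsqrtN2) : zsqrtN2 :=
  ZsqrtN2 (rat_part u + rat_part v) (irr_part u + irr_part v).
Definition zsqrtN2_mul (u v : zsqrtN2) : zsqrtN2 :=
  ZsqrtN2 (rat_part u * rat_part v - 2 * (irr_part u * irr_part v))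
          (rat_part u * irr_part v + irr_part u * rat_part v).

Lemma zsqrtN2_addA : associative zsqrtN2_add.
Proof. by move=> u v w; rewrite /zsqrtN2_add /= !addrA. Qed.

Lemma zsqrtN2_addC : commutative zsqrtN2_add.
Proof.
by move=> u v; rewrite /zsqrtN2_add (addrC (rat_part u)) (addrC (irr_part u)).
Qed.

Lemma zsqrtN2_add0 : left_id zsqrtN2_zero zsqrtN2_add.
Proof. by case=> x y; rewrite /zsqrtN2_add /= !add0r. Qed.

Lemma zsqrtN2_addN : left_inverse zsqrtN2_zero zsqrtN2_opp zsqrtN2_add.
Proof. by move=> u; rewrite /zsqrtN2_add /= !addNr. Qed.

HB.instance Definition _ := GRing.isZmodule.Build zsqrtN2
  zsqrtN2_addA zsqrtN2_addC zsqrtN2_add0 zsqrtN2_addN.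

Lemma zsqrtN2_mulA : associative zsqrtN2_mul.
Proof. by move=> u v w; rewrite /zsqrtN2_mul /=; congr ZsqrtN2; ring. Qed.

Lemma zsqrtN2_mulC : commutative zsqrtN2_mul.
Proof. by move=> u v; rewrite /zsqrtN2_mul; congr ZsqrtN2; ring. Qed.

Lemma zsqrtN2_mul1 : left_id zsqrtN2_one zsqrtN2_mul.
Proof. by case=> x y; rewrite /zsqrtN2_mul /=; congr ZsqrtN2; ring. Qed.

Lemma zsqrtN2_mulDl : left_distributive zsqrtN2_mul zsqrtN2_add.
Proof. by move=> u v w; rewrite /zsqrtN2_mul /zsqrtN2_add /=; congr ZsqrtN2; ring. Qed.

Lemma zsqrtN2_one_neq0 : zsqrtN2_one != 0.
Proof. by []. Qed.

HB.instance Definition _ := GRing.Zmodule_isComNzRing.Build zsqrtN2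
  zsqrtN2_mulA zsqrtN2_mulC zsqrtN2_mul1 zsqrtN2_mulDl zsqrtN2_one_neq0.

(* Main.v *)
Require Import Defs.
From Stdlib Require ZArith Lia Reals Lra List Zpow_facts.
From Coquelicot Require Coquelicot.
From mathcomp Require ssreflect ssrfun ssrbool all_boot all_order all_algebra.
From mathcomp Require all_fingroup all_solvable all_field.
From mathcomp Require zify ring lra ssrZ Rstruct.

(** Suppose that {1, 3, a, b, c} is a Diophantine quintuple in Z[sqrt(-2)].

    Each of a, b, c is a rational integer.  From a + 1 = X^2 and 3 a + 1 = Y^2,
    the rational and irrational parts of Y^2 - 3 X^2 = -2 and the irrationality of
    sqrt 3 leave two possibilities ([extension_kind]): a + 1 and 3 a + 1 are
    integer squares (the positive kind), or both are -2 times a square (the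
    negative kind).  Modulo 8, the first kind is 0 and the second -1 or -3.  So a b + 1
    is not a square when a and b are of different kinds, nor when they are of the
    negative kind and agree modulo 8, as two of three such numbers do
    ([mixed_kinds], [three_negative_kinds]).  What remains is a quintuple {1, 3, A, C, e} of
    positive integers with A < C < e, and [no_quintuple] excludes it.

    Take such a quintuple with e least.  Put C e + 1 = z^2.  For b = 1, 3, A, the
    equation b z^2 - C y^2 = b - C holds with y^2 = b e + 1, and dividing by
    powers of the unit (r + sqrt (b C))^2, where r^2 = b C + 1, reduces z modulo
    2 C to the range |z0| < C.  So z0 is the same for the three values of b, and
    e0 = (z0^2 - 1) / C is a smaller number whose products with 1, 3, A, C are squares
    minus 1; minimality forces it to be 0 ([quintuple_base]).  Hence z is
    a term with a known start in three sequences of Pell type, with indices m (for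
    b = 1) and n (for b = 3), say.

    If C >= 23408, two estimates for z contradict each other.
    - z is large: comparing the two expressions for z modulo 4 C^2 gives, modulo C,
      +- m^2 + s m = +- 3 n^2 + t n, with s^2 = C + 1 and t^2 = 3 C + 1.  For small
      indices this congruence is an equality, which the comparison of m with n by
      growth refutes; so n >= 25 and z > (3 C^2)^12 ([index_large], [z_large]).
    - z is small: t y / (3 z) and s x / z, with x^2 = e + 1 and y^2 = 3 e + 1, are
      close to theta1 = sqrt (1 + 1 / (3 C)) and theta2 = sqrt (1 + 1 / C).  The
      integrals over v > 0 of the powers of
      v^2 / ((v^2 + 1) (v^2 + theta1^2) (v^2 + theta2^2)) are, up to a factor, small
      positive linear forms P0 + P1 theta1 + P2 theta2 with integers P0, P1, P2 of
      controlled size ([pade_forms]): these are Hermite-Pade approximations.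
      Substituting the rational approximations gives an integer strictly
      between 0 and 1 as soon as z > (3 C^2)^12 ([pade_bound]).  Positivity of the
      integrand takes the place of the usual nonvanishing of a determinant.

    If C < 23408, then A and C are among 8, 120, 1680.  The pair {8, 1680} is
    excluded since 8 * 1680 + 1 is not a square; the pairs {8, 120} and {120, 1680}
    are excluded by quadratic reciprocity: the rational part v of a suitable
    power of the unit r + sqrt (b C) divides a number X^2 - a p Y^2, with p = 13 or
    p = 109, a = 3 or a = -1, although v is not a square modulo p
    ([no_extension_8_120], [no_extension_120_1680], [jacobi_residue]). *)

Delimit Scope Z_scope with ZZ.


(** * Quadratic reciprocity *)
Section Reciprocity.
Local Set Implicit Arguments.
Local Unset Strict Implicit.
Local Unset Printing Implicit Defensive.
Import all_boot all_order all_algebra.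
Import all_fingroup all_solvable all_field.
Import mathcomp.zify.zify mathcomp.algebra_tactics.ring.
Import Order.TTheory GRing.Theory Num.Theory.
Local Open Scope ring_scope.

Section QuadraticCharacter.
Variables (p : nat) (pp : prime p) (p2 : (2 < p)%N).
Let h := (p.-1)./2.

(** The Legendre symbol, computed by Euler's criterion. *)
Definition chi (x : 'F_p) : int := if x == 0 then 0 else if x ^+ h == 1 then 1 else -1.

Let podd : odd p.
Proof. by case: (even_prime pp) => // E; move: p2; rewrite E. Qed.

Let hE : (h + h = p.-1)%N.
Proof. by rewrite addnn /h -[RHS]odd_double_half; case: (p) podd => //= n /negbTE ->. Qed.

Lemma Fp_half_pow (x : 'F_p) : x != 0 -> x ^+ h = 1 \/ x ^+ h = -1.
Proof.
move=> x0; have e : (x ^+ h) ^+ 2 = 1 ^+ 2.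
  rewrite expr1n -exprM muln2 -addnn hE.
  apply: (mulfI x0); rewrite -exprS prednK ?prime_gt0 // mulr1.
  by have := expf_card x; rewrite card_Fp.
by have /eqP := e; rewrite eqf_sqr => /orP[] /eqP; [left | right].
Qed.

Lemma Fp_opp1_neq1 : (-1 : 'F_p) != 1.
Proof.
rewrite eq_sym -addr_eq0 -mulr2n -(dvdn_pcharf (pchar_Fp pp)).
by apply/negP => /dvdn_leq; lia.
Qed.

Lemma chi1 : chi 1 = 1.
Proof. by rewrite /chi oner_eq0 expr1n eqxx. Qed.

Lemma chi0 : chi 0 = 0.
Proof. by rewrite /chi eqxx. Qed.

Lemma chiM (x y : 'F_p) : chi (x * y) = chi x * chi y.
Proof.
rewrite /chi mulf_eq0; case: eqP => [|/eqP x0] /=; first by rewrite mul0r.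
case: eqP => [|/eqP y0] /=; first by rewrite mulr0.
rewrite exprMn; have m1 := negbTE Fp_opp1_neq1.
by case: (Fp_half_pow x0) => ->; case: (Fp_half_pow y0) => ->;
   rewrite ?mul1r ?mulr1 ?mulN1r ?opprK ?eqxx ?m1.
Qed.

Lemma chi_sign (x : 'F_p) : x != 0 -> chi x = 1 \/ chi x = -1.
Proof. by rewrite /chi => /negbTE ->; case: ifP; [left | right]. Qed.

Lemma chi_sqr (x : 'F_p) : x != 0 -> chi x * chi x = 1.
Proof. by case/chi_sign => ->. Qed.

Lemma nonresidue_exists : exists2 x : 'F_p, x != 0 & chi x = -1.
Proof.
suff /existsP[x /andP[x0 /eqP hx]] : [exists x : 'F_p, (x != 0) && (chi x == -1)] by exists x.
apply: contraT; rewrite negb_exists => /forallP hx.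
have hx1 (x : 'F_p) : x != 0 -> x ^+ h = 1.
  move=> x0; case: (Fp_half_pow x0) => // e.
  by have := hx x; rewrite x0 /chi (negbTE x0) e (negbTE Fp_opp1_neq1) eqxx.
have h0 : (0 < h)%N by move: hE; lia.
have P0 : ('X^h - 1 : {poly 'F_p}) != 0.
  by rewrite -size_poly_gt0 size_XnsubC.
have := @max_poly_roots _ _ (enum (predC1 (0 : 'F_p))) P0.
rewrite size_XnsubC // enum_uniq -cardE cardC1 card_Fp // => H.
have : (p.-1 < h.+1)%N.
  apply: H => //; apply/allP => x; rewrite mem_enum inE => x0.
  by rewrite /root !hornerE hx1 // subrr.
by move: hE h0; lia.
Qed.

Lemma sum_chi : \sum_(x : 'F_p) chi x = 0.
Proof.
have [y y0 hy] := nonresidue_exists.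
have E : \sum_(x : 'F_p) chi x = - \sum_(x : 'F_p) chi x.
  rewrite {1}(reindex_inj (mulfI y0)) -mulN1r mulr_sumr.
  by apply: eq_bigr => x _; rewrite chiM hy.
by lia.
Qed.

Section GaussSum.
Variables (K : fieldType) (z : K).
Hypotheses (z1 : z != 1) (zp : z ^+ p = 1).

Let e (x : 'F_p) : K := z ^+ x.

Let eD x y : e (x + y) = e x * e y.
Proof.
rewrite /e -exprD -[in RHS](expr_mod _ zp); congr (_ ^+ _).
have -> : x + y = ((x : nat) + y)%:R by rewrite natrD !natr_Zp.
by rewrite val_Fp_nat.
Qed.

Let sum_e c : \sum_(x : 'F_p) e (x * c) = if c == 0 then p%:R else 0.
Proof.
case: eqP => [->|/eqP c0].
  under eq_bigr => x _ do rewrite mulr0 /e expr0.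
  by rewrite sumr_const card_Fp.
rewrite -(reindex_inj (mulIf c0) (P := xpredT) (F := e)) /=.
apply: (mulIf (x := z - 1)); first by rewrite subr_eq0.
have E : \sum_x e x = \sum_x e x * z.
  rewrite (reindex_inj (addIr 1)); apply: eq_bigr => x _; rewrite eD; congr (_ * _).
by rewrite mul0r mulrBr mulr1 mulr_suml -E subrr.
Qed.

Definition gauss_sum : K := \sum_(x : 'F_p) (chi x)%:~R * e x.

(** Substituting x c for the second variable leaves, for each c, chi c times the sum
    of z^(x (1 + c)) over x <> 0.  This sum is -1 except for c = -1, and the values
    of chi add up to 0. *)
Lemma gauss_sum_sqr : gauss_sum ^+ 2 = (chi (-1) * p%:Z)%:~R.
Proof.
have E : gauss_sum ^+ 2 = \sum_(c : 'F_p) (chi c)%:~R * (\sum_(x : 'F_p) e (x * (1 + c)) - 1).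
  rewrite expr2 {1}/gauss_sum mulr_suml.
  transitivity (\sum_(x : 'F_p | x != 0) \sum_(c : 'F_p) (chi c)%:~R * e (x * (1 + c))).
    rewrite (bigID (fun x : 'F_p => x == 0)) /= big1 ?add0r; last first.
      by move=> x /eqP ->; rewrite chi0 mulr0z !mul0r.
    apply: eq_bigr => x x0; rewrite /gauss_sum mulr_sumr (reindex_inj (mulfI x0)).
    apply: eq_bigr => c _; rewrite mulrACA -eD mulrDr mulr1 -intrM chiM mulrA chi_sqr // mul1r.
    by [].
  rewrite exchange_big; apply: eq_bigr => c _.
  rewrite -mulr_sumr; congr (_ * _).
  rewrite [in RHS](bigID (fun x : 'F_p => x == 0)) /= big_pred1_eq mul0r {2}/e expr0.
  by rewrite addrAC subrr add0r.
rewrite E; under eq_bigr => c _ do rewrite sum_e mulrBr mulr1.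
rewrite sumrB -rmorph_sum sum_chi /= subr0 (bigD1 (-1)) //= addrN eqxx big1 ?addr0.
  by rewrite intrM.
move=> c c1; rewrite addrC addr_eq0 (negbTE c1) mulr0.
by [].
Qed.

Variables (l : nat) (ll : l \in [pchar K]) (l2 : (2 < l)%N) (l0 : (l%:R : 'F_p) != 0).

(** The Frobenius map fixes the values of chi and multiplies the exponents of z by
    l; the substitution x -> l x transfers this factor to chi. *)
Lemma gauss_sum_Frobenius : gauss_sum ^+ l = (chi l%:R)%:~R * gauss_sum.
Proof.
have lp := pcharf_prime ll.
rewrite -(pFrobenius_autE ll) /gauss_sum rmorph_sum mulr_sumr /=.
rewrite [RHS](reindex_inj (mulfI l0)); apply: eq_bigr => x _.
rewrite rmorphM /= rmorph_int chiM mulrA -intrM mulrA chi_sqr // mul1r.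
congr (_ * _); rewrite pFrobenius_autE /e -exprM.
rewrite -[z ^+ (x * l)](expr_mod _ zp); congr (_ ^+ _).
have -> : l%:R * x = (l * x)%:R by rewrite natrM natr_Zp.
by rewrite val_Fp_nat // mulnC.
Qed.

(** The Gauss sum G satisfies G^2 = chi (-1) p and G^(l - 1) = chi l; the
    power (l - 1) / 2 of the former is the latter. *)
Lemma euler_reciprocity :
  (chi (-1) * p%:Z)%:~R ^+ (l.-1)./2 = (chi l%:R)%:~R :> K.
Proof.
have lp := pcharf_prime ll.
have lodd : odd l by case: (even_prime lp) => // E; move: l2; rewrite E.
have g0 : gauss_sum != 0.
  rewrite -sqrf_eq0 gauss_sum_sqr intrM mulf_neq0 //.
    have n0 : (-1 : 'F_p) != 0 by rewrite oppr_eq0 oner_eq0.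
    by case: (chi_sign n0) => ->; rewrite ?rmorphN ?oppr_eq0 oner_eq0.
  rewrite -pmulrn -(dvdn_pcharf ll) dvdn_prime2 //.
  by apply: contra l0 => /eqP ->; rewrite pchar_Fp_0.
apply: (mulIf g0); rewrite -gauss_sum_Frobenius -gauss_sum_sqr -exprM -exprSr.
congr (_ ^+ _); rewrite mul2n -[RHS]prednK ?prime_gt0 //; congr _.+1.
by rewrite -[RHS]odd_double_half; case: (l) lodd => //= n /negbTE ->.
Qed.
End GaussSum.

End QuadraticCharacter.

Lemma intr_pchar_eq0 (K : fieldType) (l : nat) (n : int) :
  l \in [pchar K] -> (n%:~R == 0 :> K) = (l %| `|n|)%N.
Proof.
move=> ll; rewrite (dvdn_pcharf ll); case: n => n; first by rewrite -pmulrn absz_nat.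
by rewrite NegzE abszN absz_nat mulrNz oppr_eq0 -pmulrn.
Qed.

(** A primitive p-th root of unity exists in the field with l^(p - 1) elements,
    whose multiplicative group has order divisible by p.  The identity there lies in
    the image of the integers, so it holds modulo l. *)
Lemma reciprocity (p l : nat) : prime p -> (2 < p)%N -> prime l -> (2 < l)%N -> p != l ->
  (chi (-1 : 'F_p) * p%:Z)%:~R ^+ (l.-1)./2 = (chi (l%:R : 'F_p))%:~R :> 'F_l.
Proof.
move=> pp p2 lp l2 pl.
have k0 : (0 < p.-1)%N by lia.
have [K lK cK] := pPrimePowerField lp k0.
have l0 : (l%:R : 'F_p) != 0 by rewrite -(dvdn_pcharf (pchar_Fp pp)) dvdn_prime2.
have pU : (p %| #|[set: {unit K}]|)%N.
  rewrite card_finField_unit cK (dvdn_pcharf (pchar_Fp pp)) -subn1 natrB ?expn_gt0 ?prime_gt0 //.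
  rewrite natrX subr_eq0; apply/eqP/(mulfI l0).
  by rewrite -exprS prednK ?prime_gt0 // mulr1; have := expf_card (l%:R : 'F_p); rewrite card_Fp.
have [u _ ou] := Cauchy pp pU.
pose z := val u : K.
have z1 : z != 1.
  apply: contraTneq p2 => E; have u1 : u = 1%g by apply: val_inj.
  by rewrite -ou u1 order1.
have zp : z ^+ p = 1 by rewrite /z -FinRing.val_unitX -ou expg_order.
have := euler_reciprocity pp p2 z1 zp lK l2 l0.
move/eqP; rewrite -rmorphXn /= -subr_eq0 -rmorphB /= (intr_pchar_eq0 _ lK).
by rewrite -(intr_pchar_eq0 _ (pchar_Fp lp)) rmorphB rmorphXn /= subr_eq0 => /eqP.
Qed.

(** The nontrivial Dirichlet character modulo 4. *)
Definition chi4 (n : nat) : int :=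
  if (n %% 4 == 1)%N then 1 else if (n %% 4 == 3)%N then -1 else 0.

Lemma chi4M m n : chi4 (m * n) = chi4 m * chi4 n.
Proof.
rewrite /chi4 -modnMm; have := ltn_pmod m (isT : 0 < 4)%N; have := ltn_pmod n (isT : 0 < 4)%N.
by case: (m %% 4)%N => [|[|[|[|]]]] //; case: (n %% 4)%N => [|[|[|[|]]]].
Qed.

Lemma chi4_sign l : odd l -> (-1) ^+ (l.-1)./2 = chi4 l.
Proof.
move=> ol; rewrite /chi4 -signr_odd.
have := divn_eq l 4; have := ltn_pmod l (isT : 0 < 4)%N.
case: (l %% 4)%N => [|[|[|[|]]]] // _ E.
- by move: ol; rewrite E; lia.
- by have -> : odd (l.-1)./2 = false by lia.
- by move: ol; rewrite E; lia.
- by have -> : odd (l.-1)./2 = true by lia.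
Qed.

Lemma chi_opp1_1mod4 p k : prime p -> p = (4 * k + 1)%N -> chi (-1 : 'F_p) = 1.
Proof.
move=> pp E; rewrite /chi oppr_eq0 oner_eq0.
have -> : (p.-1)./2 = (k + k)%N by lia.
by rewrite exprD -expr2 -exprM mulnC exprM sqrrN !expr1n eqxx.
Qed.

Lemma chi_opp1_3 : chi (-1 : 'F_3) = -1.
Proof. by []. Qed.

Lemma residue_character_trivial (psi : nat -> int) v : (0 < v)%N ->
  psi 1%N = 1 -> (forall m n, psi (m * n)%N = psi m * psi n) ->
  (forall l, prime l -> l %| v -> psi l = 1)%N -> psi v = 1.
Proof.
move=> v0 psi1 psiM H.
rewrite [v]prod_prime_decomp // big_seq.
elim/big_ind: _ => //; first by move=> x y hx hy; rewrite psiM hx hy.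
move=> [l e] /mem_prime_decomp[lp e0 lv] /=.
have hl : psi l = 1 by apply: H => //; apply: dvdn_trans lv; apply: dvdn_exp.
by elim: e {e0 lv} => [|e IH]; rewrite ?expn0 // expnS psiM hl IH.
Qed.

Lemma small_sign_eq (l : nat) (x y : int) : prime l -> (2 < l)%N ->
  (x = 1 \/ x = -1) -> (y = 1 \/ y = -1) -> x%:~R = y%:~R :> 'F_l -> x = y.
Proof.
move=> lp l2 hx hy; have n1 := Fp_opp1_neq1 lp l2.
by case: hx => ->; case: hy => -> // /eqP; rewrite ?mulrN1z ?[1 == _]eq_sym (negbTE n1).
Qed.

(** Modulo a prime factor l of v, the number a p is a nonzero square.  By
    reciprocity this says psi l = 1, where psi is the product of chi modulo p, of the
    character modulo 4 if a = -1 or a = 3, and of chi modulo 3 if a = 3 or a = -3.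
    As psi is multiplicative, psi v = 1, and the factors modulo 4 and 3 are trivial
    since v = 1 modulo 12. *)
Lemma jacobi_residue_nat (p k v : nat) (X Y a : int) :
  prime p -> p = (4 * k + 1)%N -> (0 < v)%N -> (v %% 12 = 1)%N ->
  [|| a == 1, a == -1, a == 3 | a == -3] ->
  (forall l, prime l -> l %| v -> ~~ (l %| `|(p%:Z * Y)%R|))%N ->
  (v%:Z %| X ^+ 2 - a * p%:Z * Y ^+ 2)%Z ->
  chi (v%:R : 'F_p) = 1.
Proof.
move=> pp pE v0 v12 ha cop dvd.
have p2 : (2 < p)%N by have := prime_gt1 pp; lia.
have p3 : prime 3 by [].
pose psi n := chi4 n ^+ ((a == -1) || (a == 3)) * chi (n%:R : 'F_3) ^+ ((a == 3) || (a == -3))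
   * chi (n%:R : 'F_p).
have psiM m n : psi (m * n)%N = psi m * psi n.
  by rewrite /psi chi4M !natrM !chiM // !exprMn; ring.
have psi1 : psi 1%N = 1 by rewrite /psi !chi1 // !expr1n.
have psiv : psi v = chi (v%:R : 'F_p).
  rewrite /psi; have -> : chi4 v = 1 by rewrite /chi4; have -> : (v %% 4 = 1)%N by lia.
  have -> : (v%:R : 'F_3) = 1 by rewrite -(Fp_nat_mod p3); have -> : (v %% 3 = 1)%N by lia.
  by rewrite chi1 !expr1n !mul1r.
rewrite -psiv; apply: residue_character_trivial => // l lp lv.
have l12 : (l %% 2 != 0)%N /\ (l %% 3 != 0)%N.
  by move/dvdnP: lv => [c E]; rewrite E in v12; nia.
have l2 : (2 < l)%N by have := prime_gt1 lp; case: (l) l12 => [|[|[|]]] //= [].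
have lodd : odd l by lia.
have pl : p != l.
  apply: contraTneq (cop l lp lv) => ->.
  by rewrite negbK abszM dvdn_mulr.
have l3 : 3 != l by apply: contra_neq (proj2 l12) => <-.
have hl3 : chi (l%:R : 'F_3) = 1 \/ chi (l%:R : 'F_3) = -1.
  by apply: chi_sign; rewrite -(dvdn_pcharf (pchar_Fp p3)) dvdn_prime2.
have hlp : chi (l%:R : 'F_p) = 1 \/ chi (l%:R : 'F_p) = -1.
  by apply: chi_sign; rewrite -(dvdn_pcharf (pchar_Fp pp)) dvdn_prime2.
have hl4 : chi4 l = 1 \/ chi4 l = -1.
  by rewrite -chi4_sign // -signr_odd; case: odd; [right | left].
have rp := reciprocity pp p2 lp l2 pl.
have r3 := reciprocity p3 isT lp l2 l3.
rewrite (chi_opp1_1mod4 pp pE) mul1r in rp; rewrite chi_opp1_3 in r3.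
have r4 : (-1) ^+ (l.-1)./2 = (chi4 l)%:~R :> 'F_l.
  by rewrite -chi4_sign // rmorphXn /= mulrN1z.
have pchl := pchar_Fp lp.
have Yp0 : (p%:Z * Y)%:~R != 0 :> 'F_l by rewrite (intr_pchar_eq0 _ pchl) cop.
have Y0 : Y%:~R != 0 :> 'F_l by apply: contraNneq Yp0; rewrite intrM => ->; rewrite mulr0.
have pF0 : (p%:Z)%:~R != 0 :> 'F_l by apply: contraNneq Yp0; rewrite intrM => ->; rewrite mul0r.
have E : X%:~R ^+ 2 = a%:~R * (p%:Z)%:~R * Y%:~R ^+ 2 :> 'F_l.
  apply/eqP; rewrite -!rmorphXn -!rmorphM -subr_eq0 -rmorphB /= (intr_pchar_eq0 _ pchl).
  by apply: dvdn_trans lv _.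
have a0 : a%:~R != 0 :> 'F_l.
  rewrite (intr_pchar_eq0 _ pchl).
  have l1 : ~~ (l %| 1)%N by rewrite dvdn1; apply: contraTneq l2 => ->.
  have l3' : ~~ (l %| 3)%N by rewrite dvdn_prime2 // eq_sym.
  by case/or4P: ha => /eqP ->.
have X0 : X%:~R != 0 :> 'F_l.
  by rewrite -sqrf_eq0 E !mulf_neq0 // expf_neq0.
have hh : (2 * (l.-1)./2 = l.-1)%N by clear -lodd l2; lia.
have F1 (x : 'F_l) : x != 0 -> x ^+ (l.-1) = 1.
  move=> x0; apply: (mulfI x0); rewrite -exprS prednK ?prime_gt0 // mulr1.
  by have := expf_card x; rewrite card_Fp.
have key : (a%:~R : 'F_l) ^+ (l.-1)./2 * (chi (l%:R : 'F_p))%:~R = 1.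
  have /= := congr1 (fun x => x ^+ (l.-1)./2) E.
  rewrite -exprM hh F1 // [RHS]exprMn -[in RHS]exprM hh F1 // mulr1 exprMn rp.
  by move=> <-.
rewrite /psi; apply: (small_sign_eq lp l2).
- by case: hl4 => ->; case: hl3 => ->; case: hlp => ->;
   case: (_ || _); case: (_ || _); rewrite ?expr0 ?expr1; auto.
- by left.
rewrite -[RHS]key !rmorphM; congr (_ * _).
case/or4P: ha => /eqP -> /=; rewrite ?expr0 ?expr1 ?mul1r ?mulr1.
- by rewrite expr1n.
- by rewrite mulrN1z r4.
- have -> : (3 : int)%:~R = (-1) * ((-1) * 3%:Z)%:~R :> 'F_l.
    by rewrite rmorphM /= mulrN1z mulN1r mulN1r opprK.
  by rewrite exprMn r4 r3.
- by have -> : (- 3)%:~R = ((-1) * 3%:Z)%:~R :> 'F_l by []; rewrite r3.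
Qed.

End Reciprocity.

Section ReciprocityOverZ.
Import ZArith Lia.
Local Set Implicit Arguments.
Local Unset Strict Implicit.
Local Unset Printing Implicit Defensive.
Import all_boot all_order all_algebra.
Import all_fingroup all_solvable all_field.
Import mathcomp.zify.zify ssrZ.
Import Order.TTheory GRing.Theory Num.Theory.
Local Open Scope ring_scope.

Lemma Z_of_nat_expn (n m : nat) : Z.of_nat (n ^ m)%N = Z.pow (Z.of_nat n) (Z.of_nat m).
Proof.
elim: m => [|m IH] //.
by rewrite expnS Nat2Z.inj_succ Z.pow_succ_r -?IH; lia.
Qed.

(** Euler's criterion restates chi v = 1 as a congruence between integers, which a
    nonresidue v violates. *)
Lemma jacobi_residue (p k : nat) (v X Y a : Z) :
  prime p -> Z.of_nat p = (4 * Z.of_nat k + 1)%ZZ -> (0 < v)%ZZ -> (v mod 12 = 1)%ZZ ->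
  (a = 1 \/ a = -1 \/ a = 3 \/ a = -3)%ZZ ->
  (exists u w, (u * (Z.of_nat p * Y) + w * v = 1)%ZZ) ->
  Z.divide v (X * X - a * Z.of_nat p * (Y * Y))%ZZ ->
  Z.divide (Z.of_nat p) (v ^ (2 * Z.of_nat k) - 1)%ZZ.
Proof.
move=> pp pE v0 v12 ha [u [w huw]] [q hq].
have [n En] : exists n, v = Z.of_nat n by exists (Z.to_nat v); lia.
subst v.
have h1 : p = (4 * k + 1)%N by lia.
have h2 : (0 < n)%N by lia.
have h3 : (n %% 12 = 1)%N.
  have [c ->] : exists c, n = (c * 12 + 1)%N; last by rewrite modnMDl.
  exists (Z.to_nat (Z.of_nat n / 12)).
  have := Z.div_mod (Z.of_nat n) 12; have := Z.div_pos (Z.of_nat n) 12.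
  by clear -v12; lia.
have hchi : chi (n%:R : 'F_p) = 1.
  apply: (@jacobi_residue_nat p k n (int_of_Z X) (int_of_Z Y) (int_of_Z a) pp h1 h2 h3).
- by case: ha => [->|[->|[->|->]]].
- move=> l lp ln; apply/negP => lY.
  have : (l %| 1)%N.
    have : (l%:Z %| 1)%Z.
      have -> : 1 = int_of_Z u * (p%:Z * int_of_Z Y) + int_of_Z w * n%:Z :> int by lia.
      by apply: rpredD; apply: dvdz_mull.
    by [].
  by rewrite dvdn1 => /eqP E; rewrite E in lp.
- have -> : int_of_Z X ^+ 2 - int_of_Z a * p%:Z * int_of_Z Y ^+ 2 = int_of_Z q * n%:Z.
    by rewrite !expr2; lia.
  exact: dvdz_mull.
have : (n ^ (2 * k))%:R = 1 :> 'F_p.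
  move: hchi; rewrite /chi; case: eqP => // _; case: eqP => // h _.
  by rewrite natrX -[RHS]h; congr (_ ^+ _); rewrite h1; lia.
have n1 : (0 < n ^ (2 * k))%N by rewrite expn_gt0 h2.
move/eqP; rewrite -subr_eq0 -(@natrB _ _ 1%N) // -(dvdn_pcharf (pchar_Fp pp)).
move/dvdnP => [c hc]; exists (Z.of_nat c).
have E : (Z.of_nat n ^ (2 * Z.of_nat k))%ZZ = Z.of_nat (n ^ (2 * k))%N.
  rewrite Z_of_nat_expn; congr Z.pow; lia.
by rewrite E; lia.
Qed.

End ReciprocityOverZ.


(** * Pell equations *)
Section PellRecurrence.
Import ZArith Lia ssreflect ssrfun ssrbool.
Local Open Scope Z_scope.

(** The coefficients of (r + sqrt D)^(2 m) when r^2 = D + 1.  The unit r + sqrt D has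
    norm 1 too, but multiplication by its square, unlike multiplication by itself,
    preserves the residue of a solution modulo 2 C: see [pell_reduce]. *)
Fixpoint pell (D r : Z) (m : nat) : Z * Z :=
  match m with
  | O => (1, 0)
  | S m' => let: (A, B) := pell D r m' in
            ((2 * D + 1) * A + 2 * r * D * B, 2 * r * A + (2 * D + 1) * B)
  end.

End PellRecurrence.

Local Notation pellA D r m := (fst (pell D r m)).
Local Notation pellB D r m := (snd (pell D r m)).

Section PellDescent.
Import ZArith Lia ssreflect ssrfun ssrbool.
Local Open Scope Z_scope.

Lemma pellS D r m :
  pellA D r (S m) = (2 * D + 1) * pellA D r m + 2 * r * D * pellB D r m /\
  pellB D r (S m) = 2 * r * pellA D r m + (2 * D + 1) * pellB D r m.
Proof. by rewrite /=; case: (pell D r m). Qed.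

Lemma pell_norm D r m : r * r = D + 1 ->
  pellA D r m * pellA D r m - D * (pellB D r m * pellB D r m) = 1.
Proof.
move=> hr; elim: m => [|m IH]; first by (cbn [pell fst snd]; ring).
case: (pellS D r m) => -> ->.
set A := pellA D r m in IH *; set B := pellB D r m in IH *.
have -> : ((2 * D + 1) * A + 2 * r * D * B) * ((2 * D + 1) * A + 2 * r * D * B) -
   D * ((2 * r * A + (2 * D + 1) * B) * (2 * r * A + (2 * D + 1) * B))
  = ((2 * D + 1) * (2 * D + 1) - 4 * D * (r * r)) * (A * A - D * (B * B)) by ring.
by rewrite IH hr; ring.
Qed.

(** Each inequality is between positive numbers; after squaring, the equation turns
    it into one that is clear from b < C and C <= z. *)
Lemma pell_step_bounds b C r z y : 0 < b < C -> r * r = b * C + 1 -> 0 < r ->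
  0 < y -> b * z * z - C * y * y = b - C -> C <= z ->
  0 < (2 * (b * C) + 1) * y - 2 * r * b * z < y.
Proof.
move=> hb hr r0 y0 h zC; split.
- have h1 : (2 * r * b * z) * (2 * r * b * z) < ((2 * (b * C) + 1) * y) * ((2 * (b * C) + 1) * y).
    have -> : (2 * r * b * z) * (2 * r * b * z) = 4 * (r * r) * b * (b * z * z) by ring.
    have -> : b * z * z = C * y * y + b - C by lia.
    rewrite hr.
    have -> : (2 * (b * C) + 1) * y * ((2 * (b * C) + 1) * y) =
       4 * (b * C + 1) * b * (C * y * y + b - C) + y * y + 4 * (b * C + 1) * b * (C - b) by ring.
    have : 0 <= 4 * (b * C + 1) * b * (C - b) by repeat apply: Z.mul_nonneg_nonneg; nia.
    by nia.
  have : 0 < (2 * (b * C) + 1) * y by nia.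
  by nia.
- suff : C * y < r * z by nia.
  have h1 : (C * y) * (C * y) < (r * z) * (r * z).
    have -> : (C * y) * (C * y) = C * (C * y * y) by ring.
    have -> : (r * z) * (r * z) = (r * r) * (z * z) by ring.
    have -> : C * y * y = b * z * z + C - b by lia.
    by rewrite hr; nia.
  have : 0 < r * z by nia.
  by nia.
Qed.

(** Dividing by the unit decreases y as long as z >= C, and it does not lead to a
    solution with z <= -C. *)
Lemma pell_descent b C r z y : 0 < b < C -> r * r = b * C + 1 -> 0 < r ->
  0 < y -> - C < z -> b * z * z - C * y * y = b - C ->
  exists m z0 y0, [/\ - C < z0 < C, 0 < y0, b * z0 * z0 - C * y0 * y0 = b - C,
    z = pellA (b * C) r m * z0 + pellB (b * C) r m * C * y0
  & y = pellA (b * C) r m * y0 + pellB (b * C) r m * b * z0].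
Proof.
move=> hb hr r0.
have [n hn] : exists n : nat, y <= Z.of_nat n by exists (Z.to_nat y); lia.
elim: n z y hn => [|n IH] z y hn y0 zC h; first by lia.
case: (Z_lt_ge_dec z C) => hz.
  by exists O, z, y; split => //; cbn [pell fst snd]; lia.
have hz' : C <= z by lia.
have hy := pell_step_bounds b C r z y hb hr r0 y0 h hz'.
pose z' := (2 * (b * C) + 1) * z - 2 * r * C * y.
pose y' := (2 * (b * C) + 1) * y - 2 * r * b * z.
have hy' : 0 < y' < y by [].
have zE : z = (2 * (b * C) + 1) * z' + 2 * r * C * y'.
  have -> : (2 * (b * C) + 1) * z' + 2 * r * C * y' =
    (2 * (b * C) + 1) * (2 * (b * C) + 1) * z - 4 * (r * r) * (b * C) * z
    by rewrite /z' /y'; ring.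
  by rewrite hr; ring.
have yE : y = (2 * (b * C) + 1) * y' + 2 * r * b * z'.
  have -> : (2 * (b * C) + 1) * y' + 2 * r * b * z' =
    (2 * (b * C) + 1) * (2 * (b * C) + 1) * y - 4 * (r * r) * (b * C) * y
    by rewrite /z' /y'; ring.
  by rewrite hr; ring.
have h' : b * z' * z' - C * y' * y' = b - C.
  rewrite -h.
  have -> : b * z' * z' - C * y' * y' =
     ((2 * (b * C) + 1) * (2 * (b * C) + 1) - 4 * (r * r) * (b * C)) * (b * z * z - C * y * y)
    by rewrite /z' /y'; ring.
  by rewrite hr; ring.
have hzC : - C < z'.
  (* otherwise the step from (- z', y') would have to decrease y' while leading to y *)
  case: (Z_lt_ge_dec (- C) z') => // hle.
  have h2 : b * (- z') * (- z') - C * y' * y' = b - C by rewrite -h'; ring.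
  have hyp : C <= - z' by lia.
  have := pell_step_bounds b C r (- z') y' hb hr r0 (proj1 hy') h2 hyp.
  have -> : (2 * (b * C) + 1) * y' - 2 * r * b * (- z') = y by rewrite yE; ring.
  by lia.
have [||m [z0 [y1 [hz0 hy1 hn1 zz yy]]]] := IH z' y' _ _ hzC h'; try lia.
exists (S m), z0, y1; split => //.
- case: (pellS (b * C) r m) => -> ->; rewrite zE zz yy; ring.
- case: (pellS (b * C) r m) => -> ->; rewrite yE zz yy; ring.
Qed.

(** With these moduli, z = A z0 + B C y0 is known modulo 4 C^2 from its index m; in
    particular z = z0 modulo 2 C. *)
Lemma pell_mod b C r m : r * r = b * C + 1 ->
  (exists k, pellA (b * C) r m = 1 + 2 * b * C * Z.of_nat m * Z.of_nat m + 4 * C * C * k) /\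
  (exists k, pellB (b * C) r m = 2 * r * Z.of_nat m + 4 * C * k).
Proof.
move=> hr; elim: m => [|m [[k hk] [k' hk']]].
  by by split; exists 0; cbn [pell fst snd Z.of_nat]; ring.
case: (pellS (b * C) r m) => -> ->; rewrite hk hk'.
have -> : Z.of_nat (S m) = Z.of_nat m + 1 by lia.
set M := Z.of_nat m.
split.
- exists (k * (2 * b * C + 1) + b * b * M * M + 2 * r * b * k' + b * b * M).
  transitivity ((2 * (b * C) + 1) * (1 + 2 * b * C * M * M + 4 * C * C * k) +
    2 * b * C * (2 * M * (r * r) + 4 * C * k' * r)); first by ring.
  by rewrite hr; ring.
- exists (r * b * M * M + 2 * r * C * k + (2 * b * C + 1) * k' + r * b * M).
  ring.
Qed.

End PellDescent.


(** * A quintuple with least greatest element *)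
Section LeastQuintuple.
Import ZArith Lia ssreflect ssrfun ssrbool.
Local Open Scope Z_scope.

Definition Zsquare (x : Z) : Prop := exists y, x = y * y.

Lemma Zsquare_pos x : Zsquare x -> 0 < x -> exists y, 0 < y /\ x = y * y.
Proof. by case=> y -> h; exists (Z.abs y); nia. Qed.

(** The factor 1 makes the conditions uniform: b C + 1 and b e + 1 are squares for
    b = 1, 3, A. *)
Definition quintuple (A C e : Z) : Prop :=
  [/\ 0 < A < C, C < e,
      [/\ Zsquare (1 * A + 1), Zsquare (1 * C + 1) & Zsquare (1 * e + 1)],
      [/\ Zsquare (3 * A + 1), Zsquare (3 * C + 1) & Zsquare (3 * e + 1)]
    & [/\ Zsquare (A * C + 1), Zsquare (A * e + 1) & Zsquare (C * e + 1)]].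

Lemma between_squares k x : 0 <= k -> k * k < x < (k + 1) * (k + 1) -> ~ Zsquare x.
Proof.
move=> k0 h [y hy]; have hy' : Z.abs y * Z.abs y = x by nia.
have : k < Z.abs y by nia.
have : Z.abs y < k + 1 by nia.
lia.
Qed.

Lemma small_multiple N d : 0 < N -> - N < N * d < N -> d = 0.
Proof. nia. Qed.

Lemma triple_gt3 C : 0 < C -> Zsquare (1 * C + 1) -> Zsquare (3 * C + 1) -> 3 < C.
Proof.
move=> C0 hs ht.
have [h|h] : 3 < C \/ C <= 3 by lia.
  exact: h.
have [E|[E|E]] : C = 1 \/ C = 2 \/ C = 3 by lia.
- by subst C; exfalso; move: hs; apply: (between_squares 1); lia.
- by subst C; exfalso; move: hs; apply: (between_squares 1); lia.
- by subst C; exfalso; move: ht; apply: (between_squares 3); lia.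
Qed.

Lemma consecutive_not_square x : 0 < x -> ~ Zsquare (x * x + 1).
Proof. by move=> x0; apply: (between_squares x); lia. Qed.

(** At most one number z0 with |z0| < C is congruent to z modulo 2 C: so z0 depends
    on z and C alone, not on b. *)
Lemma pell_reduce b C e z : 0 < b < C -> 0 < z -> C * e + 1 = z * z ->
  Zsquare (b * C + 1) -> Zsquare (b * e + 1) -> 0 < e ->
  exists r m z0 y0, [/\ 0 < r, r * r = b * C + 1, -C < z0 < C, 0 < y0
    & [/\ b * z0 * z0 - C * y0 * y0 = b - C, (exists k, z = z0 + 2 * C * k),
         z = pellA (b * C) r m * z0 + pellB (b * C) r m * C * y0
       & b * e + 1 = (pellA (b * C) r m * y0 + pellB (b * C) r m * b * z0) *
                     (pellA (b * C) r m * y0 + pellB (b * C) r m * b * z0)]].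
Proof.
move=> hb z0 hz hr hy e0.
have [|r [r0 {}hr]] := Zsquare_pos _ hr; first by nia.
have [|y [y0 {}hy]] := Zsquare_pos _ hy; first by nia.
have h : b * z * z - C * y * y = b - C.
  have -> : b * z * z - C * y * y = b * (z * z) - C * (y * y) by ring.
  by rewrite -hz -hy; ring.
have [|m [z1 [y1 [hz1 hy1 h1 zz yy]]]] := pell_descent b C r z y hb (esym hr) r0 y0 _ h.
  by lia.
exists r, m, z1, y1; split => //; split => //; last by rewrite -yy.
have [[k hk] [k' hk']] := pell_mod b C r m (esym hr).
rewrite zz hk hk'.
exists ((b * Z.of_nat m * Z.of_nat m + 2 * C * k) * z1 + (r * Z.of_nat m + 2 * C * k') * y1).
ring.
Qed.

(** Let w be the z0 of [pell_reduce], common to b = 1, 3, A.  The number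
    e0 = (w^2 - 1) / C satisfies 0 <= e0 < C, and b e0 + 1 is a square for these b.
    If e0 > 0, then e0 <> A, as A^2 + 1 is no square, and A, C, e0 form a quintuple
    with greatest element C < e.  So e0 = 0, and d = w is 1 or -1. *)
Lemma quintuple_base A C e :
  (forall A' C' e', quintuple A' C' e' -> e <= e') -> quintuple A C e ->
  exists d z, [/\ d = 1 \/ d = -1, 0 < z, C * e + 1 = z * z &
    forall b, b = 1 \/ b = 3 \/ b = A ->
    exists r m, [/\ 0 < r, r * r = b * C + 1,
      z = d * pellA (b * C) r m + C * pellB (b * C) r m
    & b * e + 1 = (pellA (b * C) r m + d * b * pellB (b * C) r m) *
                  (pellA (b * C) r m + d * b * pellB (b * C) r m)]].
Proof.
move=> hmin [hAC hCe [hA1 hC1 he1] [hA3 hC3 he3] [hAC1 hAe hCe1]].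
have A3 := triple_gt3 A (proj1 hAC) hA1 hA3.
have [|z [z0 hz]] := Zsquare_pos _ hCe1; first by nia.
have red b : b = 1 \/ b = 3 \/ b = A -> _ := fun hb =>
  pell_reduce b C e z (ltac:(lia)) z0 hz
   (ltac:(by case: hb => [|[|]] ->)) (ltac:(by case: hb => [|[|]] ->)) (ltac:(lia)).
have [r1 [m1 [w [y1 [r10 hr1 hw hy1 [n1 [k1 hk1] zz1 ee1]]]]]] := red 1 (or_introl erefl).
have uniq b : b = 1 \/ b = 3 \/ b = A ->
   exists r m y, [/\ 0 < r, r * r = b * C + 1, 0 < y & [/\ b * w * w - C * y * y = b - C,
         z = pellA (b * C) r m * w + pellB (b * C) r m * C * y
       & b * e + 1 = (pellA (b * C) r m * y + pellB (b * C) r m * b * w) *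
                     (pellA (b * C) r m * y + pellB (b * C) r m * b * w)]].
  move=> hb; have [r [m [w' [y [r0 hr hw' hy [n [k hk] zz ee]]]]]] := red b hb.
  have E : w' = w.
    have h : 2 * C * (k1 - k) = w' - w by lia.
    have h' : k1 - k = 0 by apply: (small_multiple (2 * C)); lia.
    by rewrite h' in h; lia.
  by exists r, m, y; rewrite -E.
have [e0 he0] : exists e0, 1 * e0 + 1 = y1 * y1 by exists (y1 * y1 - 1); ring.
have Cw : C * e0 + 1 = w * w by clear - n1 he0; nia.
have sqb b : b = 1 \/ b = 3 \/ b = A -> exists y, 0 < y /\ b * e0 + 1 = y * y.
  move=> hb; have [r [m [y [_ _ y0 [n _ _]]]]] := uniq b hb.
  exists y; split => //.
  have h : b * (w * w) - C * (y * y) = b - C by rewrite -n; ring.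
  rewrite -Cw in h.
  have : b * e0 + 1 - y * y = 0 by apply: (small_multiple C); lia.
  by lia.
have e0C : 0 <= e0 < C by clear - hw hy1 he0 Cw; split; nia.
have sq1 : Zsquare (1 * e0 + 1) by exists y1.
have sq3 : Zsquare (3 * e0 + 1) by have [|y [_ ?]] := sqb 3; [lia | exists y].
have sqA : Zsquare (A * e0 + 1) by have [|y [_ ?]] := sqb A; [lia | exists y].
have sqC : Zsquare (C * e0 + 1) by exists w.
have e00 : e0 = 0.
  have [//|e0p] : e0 = 0 \/ 0 < e0 by lia.
  have [e0A|[e0A|e0A]] : e0 < A \/ e0 = A \/ A < e0 by lia.
  - have : e <= C; last lia.
    by apply: (hmin e0 A C); split => //; try lia; split => //; rewrite Z.mul_comm.
  - by subst e0; case: (consecutive_not_square A); first lia.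
  - have : e <= C; last lia.
    by apply: (hmin A e0 C); split => //; try lia; split => //; rewrite Z.mul_comm.
subst e0.
have hw1 : w = 1 \/ w = -1 by clear - Cw; nia.
exists w, z; split => // b hb.
have [r [m [y [r0 hr y0 [n zz ee]]]]] := uniq b hb.
have y1E : y = 1.
  have h : w * w = 1 by lia.
  have h' : b * (w * w) - C * (y * y) = b - C by rewrite -n; ring.
  rewrite h in h'. have yy1 : y * y - 1 = 0 by apply: (small_multiple C); lia.
  by clear - yy1 y0; nia.
exists r, m; split => //.
- by rewrite zz y1E; ring.
- by rewrite ee y1E; ring.
Qed.

End LeastQuintuple.


(** * A lower bound for the indices *)
Section IndexBounds.
Import ZArith Lia ssreflect ssrfun ssrbool.
Local Open Scope Z_scope.

Section Growth.
Variables (D r : Z) (D0 : 0 < D) (r0 : 0 < r) (hr : r * r = D + 1).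

Lemma pell_pos m : 1 <= pellA D r m /\ 0 <= pellB D r m.
Proof.
elim: m => [|m [hA hB]]; first by (cbn [pell fst snd]; lia).
by case: (pellS D r m) => -> ->; nia.
Qed.

Lemma pell_A_ge m : D * pellB D r m <= r * pellA D r m.
Proof.
have hn := pell_norm D r m hr; have [hA hB] := pell_pos m.
set A := pellA D r m in hn hA *; set B := pellB D r m in hn hB *.
have h : (D * B) * (D * B) <= (r * A) * (r * A).
  have -> : (r * A) * (r * A) = (r * r) * (A * A) by ring.
  have -> : A * A = D * (B * B) + 1 by lia.
  by rewrite hr; nia.
have : 0 <= r * A by nia.
by clear - h; nia.
Qed.

Lemma pell_A_le m : pellA D r (S m) <= r * pellB D r (S m).
Proof.
have hn := pell_norm D r (S m) hr; have [hA hB] := pell_pos (S m).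
have hB1 : 1 <= pellB D r (S m).
  by case: (pellS D r m) => _ ->; have [? ?] := pell_pos m; nia.
set A := pellA D r (S m) in hn hA *; set B := pellB D r (S m) in hn hB hB1 *.
have h : A * A <= (r * B) * (r * B).
  have -> : (r * B) * (r * B) = (r * r) * (B * B) by ring.
  have -> : A * A = D * (B * B) + 1 by lia.
  by rewrite hr; nia.
have : 0 <= r * B by nia.
by clear - h; nia.
Qed.

(** B is multiplied at each step by a factor between 4 D and 4 D + 3. *)
Lemma pell_B_growth m :
  2 * r * (4 * D) ^ Z.of_nat m <= pellB D r (S m) <= 2 * r * (4 * D + 3) ^ Z.of_nat m.
Proof.
elim: m => [|m [IH1 IH2]].
  by case: (pellS D r O) => _ ->; cbn [pell fst snd]; rewrite !Z.pow_0_r; lia.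
have -> : Z.of_nat (S m) = Z.succ (Z.of_nat m) by lia.
rewrite !Z.pow_succ_r; try lia.
case: (pellS D r (S m)) => _ ->.
have h1 := pell_A_ge (S m); have h2 := pell_A_le m; have [hA hB] := pell_pos (S m).
set A := pellA D r (S m) in h1 h2 hA *; set B := pellB D r (S m) in h1 h2 hB IH1 IH2 *.
have h3 : r * A <= (D + 1) * B by rewrite -hr; nia.
set X := (4 * D) ^ Z.of_nat m in IH1 *; set Y := (4 * D + 3) ^ Z.of_nat m in IH2 *.
split.
- by have : 4 * D * (2 * r * X) <= 4 * D * B; nia.
- by have : (4 * D + 3) * B <= (4 * D + 3) * (2 * r * Y); nia.
Qed.

End Growth.

(** Used with 4 C >= 93632 = 4 * 23408 to refute (4 C)^j <= (9 / 5) (13 / 4)^k for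
    j = 3, and for j = 1 when k <= 9. *)
Lemma pow_ratio_small k : Z.of_nat k <= 23 ->
  9 * 13 ^ Z.of_nat k < 5 * 4 ^ Z.of_nat k * 93632 ^ 3 /\
  (Z.of_nat k <= 9 -> 9 * 13 ^ Z.of_nat k < 5 * 4 ^ Z.of_nat k * 93632).
Proof.
move=> hk.
do 24 (destruct k as [|k]; [split; [reflexivity | by move=> h; first [reflexivity | lia]] |]).
by lia.
Qed.

Section Index.
Variables (C s t : Z).
Hypotheses (hC : 23408 <= C) (s0 : 0 < s) (t0 : 0 < t)
  (hs : s * s = C + 1) (ht : t * t = 3 * C + 1).

(** The number 23408 = 153^2 - 1 is the first one after 1680 that extends {1, 3}, and
    t / s is close to sqrt 3. *)
Lemma st_bounds : 153 <= s /\ 173 * s <= 100 * t /\ 100 * t <= 174 * s.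
Proof.
have h1 : 153 <= s by nia.
split => //.
have : (173 * s) * (173 * s) <= (100 * t) * (100 * t) by nia.
have : (100 * t) * (100 * t) <= (174 * s) * (174 * s) by nia.
by clear - s0 t0; nia.
Qed.

(** The term of index m for b = 1 is of the order of s (4 C)^m, that of index n + 1 for
    b = 3 of the order of t (12 C)^(n + 1).  If m exceeded n + 1 by j > 0, then
    (4 C)^j would be at most (9 / 5) (13 / 4)^n. *)
Lemma index_compare (d z : Z) (m n : nat) : d = 1 \/ d = -1 ->
  z = d * pellA C s m + C * pellB C s m ->
  z = d * pellA (3 * C) t (S n) + C * pellB (3 * C) t (S n) ->
  Z.of_nat n <= 23 ->
  Z.of_nat m <= Z.of_nat n + 3 /\ (Z.of_nat n <= 9 -> Z.of_nat m <= Z.of_nat n + 1).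
Proof.
move=> hd zm zn n23.
have [s153 [st1 st2]] := st_bounds.
have key : forall j, m = (n + 1 + S j)%nat ->
   5 * 4 ^ Z.of_nat n * (4 * C) ^ Z.of_nat (S j) <= 9 * 13 ^ Z.of_nat n.
  move=> j E.
  have {E} E : m = S (n + S j) by lia.
  rewrite E in zm => {E}.
  have hs' : s * s = C + 1 := hs.
  have ht' : t * t = 3 * C + 1 := ht.
  have C0 : 0 < C by lia.
  have C30 : 0 < 3 * C by lia.
  have [g1 _] := pell_B_growth C s C0 s0 hs' (n + S j).
  have [_ g2] := pell_B_growth (3 * C) t C30 t0 ht' n.
  have a1 := pell_A_le C s C0 s0 hs' (n + S j).
  have a2 := pell_A_le (3 * C) t C30 t0 ht' n.
  have [p1 q1] := pell_pos C s C0 s0 hs' (S (n + S j)).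
  have [p2 q2] := pell_pos (3 * C) t C30 t0 ht' (S n).
  move: zm zn g1 g2 a1 a2 p1 q1 p2 q2.
  set A1 := pellA C s _; set B1 := pellB C s _; set A2 := pellA _ _ _; set B2 := pellB _ _ _.
  move=> zm zn g1 g2 a1 a2 p1 q1 p2 q2.
  have z1 : (C - s) * B1 <= z by clear - zm hd a1 p1; case: hd => ?; subst d; nia.
  have z2 : z <= (C + t) * B2 by clear - zn hd a2 p2; case: hd => ?; subst d; nia.
  have Cs : 0 < C - s by clear - hs s153; nia.
  have h1 : (C - s) * (2 * s * (4 * C) ^ Z.of_nat (n + S j)) <=
            (C + t) * (2 * t * (4 * (3 * C) + 3) ^ Z.of_nat n).
    apply: Z.le_trans; first by apply: Z.mul_le_mono_nonneg_l g1; lia.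
    apply: Z.le_trans; first exact: z1.
    apply: Z.le_trans; first exact: z2.
    by apply: Z.mul_le_mono_nonneg_l g2; lia.
  have h2 : (4 * (3 * C) + 3) ^ Z.of_nat n <= (13 * C) ^ Z.of_nat n.
    by apply: Z.pow_le_mono_l; lia.
  have h3 : 5 * ((C + t) * t) <= 9 * ((C - s) * s).
    have b1 : 100 * ((C + t) * t) <= 174 * ((C + t) * s) by clear - st2 t0 hC; nia.
    have b2 : 150 * (C + t) <= 153 * (C - s) by clear - st2 hs s153; nia.
    have b3 : 150 * (C + t) * s <= 153 * (C - s) * s by apply: Z.mul_le_mono_nonneg_r; lia.
    have b4 : 0 <= (C - s) * s by apply: Z.mul_nonneg_nonneg; lia.
    by clear - b1 b3 b4; lia.
  rewrite Nat2Z.inj_add Z.pow_add_r in h1; [|by clear; lia|by clear; lia].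
  rewrite !Z.pow_mul_l in h1 h2 *.
  set P4 := 4 ^ Z.of_nat n in h1 h2 *; set PC := C ^ Z.of_nat n in h1 h2.
  set P13 := 13 ^ Z.of_nat n in h1 h2 *.
  set Q := 4 ^ Z.of_nat (S j) * C ^ Z.of_nat (S j) in h1 *.
  set U := (4 * (3 * C) + 3) ^ Z.of_nat n in h1 h2.
  have PC0 : 0 < PC by apply: Z.pow_pos_nonneg; lia.
  have P130 : 0 < P13 by apply: Z.pow_pos_nonneg; lia.
  have U1 : (C + t) * (2 * t * U) <= (C + t) * (2 * t * (P13 * PC)).
    by apply: Z.mul_le_mono_nonneg_l; [lia | apply: Z.mul_le_mono_nonneg_l; lia].
  have h4 : 5 * ((C - s) * s) * (P4 * Q) * PC <= 9 * ((C - s) * s) * P13 * PC.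
    apply: (Z.le_trans _ (5 * ((C + t) * t) * P13 * PC)).
      by clear - h1 U1; lia.
    by apply: Z.mul_le_mono_nonneg_r; [lia | apply: Z.mul_le_mono_nonneg_r; lia].
  have W0 : 0 < (C - s) * s * PC by apply: Z.mul_pos_pos => //; apply: Z.mul_pos_pos.
  apply: (Zmult_le_reg_r _ _ ((C - s) * s * PC)); first lia.
  by clear - h4; lia.
have [k1 k2] := pow_ratio_small n n23.
split.
- case: (Z_le_gt_dec (Z.of_nat m) (Z.of_nat n + 3)) => // hm; exfalso.
  have [j Ej] : exists j, m = (n + 1 + S (S (S j)))%nat by exists (m - n - 4)%nat; lia.
  have := key _ Ej.
  have : 93632 ^ 3 <= (4 * C) ^ Z.of_nat (S (S (S j))).
    apply: (Z.le_trans _ ((4 * C) ^ 3)); first by apply: Z.pow_le_mono_l; lia.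
    by apply: Z.pow_le_mono_r; lia.
  have : 0 < 4 ^ Z.of_nat n by apply: Z.pow_pos_nonneg; lia.
  by clear - k1; nia.
- move=> n9; case: (Z_le_gt_dec (Z.of_nat m) (Z.of_nat n + 1)) => // hm; exfalso.
  have [j Ej] : exists j, m = (n + 1 + S j)%nat by exists (m - n - 2)%nat; lia.
  have := key _ Ej.
  have : 93632 <= (4 * C) ^ Z.of_nat (S j).
    apply: (Z.le_trans _ ((4 * C) ^ 1)); first by lia.
    by apply: Z.pow_le_mono_r; lia.
  have : 0 < 4 ^ Z.of_nat n by apply: Z.pow_pos_nonneg; lia.
  by have := k2 n9; clear; nia.
Qed.

(** Modulo C, the equality of the two expressions reads
    d m^2 + s m = 3 d n^2 + t n.  For n <= 24 the difference of the two sides is less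
    than C in absolute value, s and t being of the order of sqrt C, so equality
    holds.  But t n - s m exceeds 3 n^2, by the bounds for m in terms of n, whereas
    d (m^2 - 3 n^2) does not. *)
Lemma index_large (d z : Z) (m n : nat) : d = 1 \/ d = -1 -> 1 < z ->
  z = d * pellA C s m + C * pellB C s m ->
  z = d * pellA (3 * C) t n + C * pellB (3 * C) t n -> 25 <= Z.of_nat n.
Proof.
move=> hd z1 zm zn.
case: (Z_le_gt_dec 25 (Z.of_nat n)) => // hn; exfalso.
case: n zn hn => [|n] zn hn.
  by move: zn; cbn [pell fst snd]; lia.
have [M3 M1] := index_compare d z m n hd zm zn (ltac:(lia)).
have [s153 [st1 st2]] := st_bounds.
have hs1 : s * s = 1 * C + 1 by lia.
have [] := pell_mod 1 C s m hs1; rewrite Z.mul_1_l => -[k1 e1] [k2 e2].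
have [[k3 e3] [k4 e4]] := pell_mod 3 C t (S n) ht.
rewrite e1 e2 in zm; rewrite e3 e4 in zn.
have N0 : 1 <= Z.of_nat (S n) <= 24 by lia.
have M0 : 0 <= Z.of_nat m by lia.
have EN : Z.of_nat n = Z.of_nat (S n) - 1 by lia.
rewrite EN in M3 M1.
set M := Z.of_nat m in M0 M1 M3 zm; set N := Z.of_nat (S n) in N0 M1 M3 zn EN.
pose K := k4 * 2 + d * 2 * k3 - (d * 2 * k1 + 2 * k2).
have E : (2 * C) * ((d * M * M + s * M - (3 * d * N * N + t * N)) - C * K) = 0.
  by rewrite /K; clear - zm zn; lia.
clearbody K.
have E1 : d * M * M + s * M - (3 * d * N * N + t * N) = C * K.
  have E0 : d * M * M + s * M - (3 * d * N * N + t * N) - C * K = 0.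
    by apply: (small_multiple (2 * C)); rewrite ?E; clear - hC; lia.
  by clear - E0; lia.
have K0 : K = 0.
  apply: (small_multiple C); first by lia.
  rewrite -E1.
  have b1 : 0 <= M * M <= 26 * 26 by clear - M0 M3 N0; nia.
  have b2 : 0 <= N * N <= 24 * 24 by clear - N0; nia.
  have b3 : 0 <= s * M <= 26 * s by clear - M0 M3 N0 s0; nia.
  have b4 : 0 <= t * N <= 24 * t by clear - N0 t0; nia.
  have b5 : 2404 + 26 * s < C by clear - s153 hs; nia.
  have b6 : 2404 + 24 * t < C by clear - s153 st2 hs; nia.
  by clear - hd b1 b2 b3 b4 b5 b6; case: hd => ?; subst d; lia.
rewrite K0 in E1.
have E2 : t * N - s * M <= 3 * (N * N).
  have hM : M * M <= 4 * (N * N).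
    have h : M <= 2 * N by case: (Z_le_gt_dec N 10) => hN; lia.
    by clear - h M0; nia.
  by clear - E1 hd hM; case: hd => ?; subst d; nia.
have [hN|hN] : N <= 10 \/ 11 <= N by lia.
- have hM : M <= N by lia.
  have : 110 * N <= t * N - s * M by clear - hM N0 s0 M0 st1 s153; nia.
  by clear - hN N0 E2; nia.
- have hM : M <= N + 2 by lia.
  have h1 : (73 * N - 200) * s <= 100 * (t * N - s * M) by clear - hM N0 s0 M0 st1; nia.
  have h2 : (73 * N - 200) * 153 <= (73 * N - 200) * s by clear - hN s153; nia.
  by clear - hN N0 E2 h1 h2; nia.
Qed.

(** From z >= B >= (12 C)^24. *)
Lemma z_large (d z : Z) (n : nat) : d = 1 \/ d = -1 ->
  z = d * pellA (3 * C) t n + C * pellB (3 * C) t n -> 25 <= Z.of_nat n ->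
  (3 * C * C) ^ 12 < z.
Proof.
move=> hd zn hn.
have {hn} [k E] : exists k, n = S (24 + k) by exists (n - 25)%nat; lia.
subst n.
have ht' : t * t = 3 * C + 1 := ht.
have C30 : 0 < 3 * C by lia.
have [g _] := pell_B_growth (3 * C) t C30 t0 ht' (24 + k).
have a := pell_A_le (3 * C) t C30 t0 ht' (24 + k).
have [p q] := pell_pos (3 * C) t C30 t0 ht' (S (24 + k)).
move: zn g a p q; set A := pellA _ _ _; set B := pellB _ _ _ => zn g a p q.
have [s153 [st1 st2]] := st_bounds.
have ht2 : t + 1 <= C by nia.
have zB : B <= z by clear - zn hd a p q ht2; case: hd => ?; subst d; nia.
have h1 : (4 * (3 * C)) ^ 24 <= (4 * (3 * C)) ^ Z.of_nat (24 + k).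
  by apply: Z.pow_le_mono_r; lia.
have h2 : (3 * C * C) ^ 12 <= (4 * (3 * C)) ^ 24.
  have -> : (4 * (3 * C)) ^ 24 = ((4 * (3 * C)) ^ 2) ^ 12 by rewrite -Z.pow_mul_r.
  by apply: Z.pow_le_mono_l; clear - C30; split; nia.
have h3 : 0 < (3 * C * C) ^ 12 by apply: Z.pow_pos_nonneg; clear - C30; nia.
by clear - h1 h2 h3 g zB t0; nia.
Qed.

End Index.

End IndexBounds.


(** * The pairs {8, 120} and {120, 1680} *)
Section SmallQuintuples.
Import ZArith Lia List Zpow_facts ssreflect ssrfun ssrbool.
Local Open Scope Z_scope.

Section Divisibility.
Variables (D r : Z).

Lemma pell_add m n :
  pellA D r (m + n) = pellA D r m * pellA D r n + D * pellB D r m * pellB D r n /\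
  pellB D r (m + n) = pellA D r m * pellB D r n + pellB D r m * pellA D r n.
Proof.
elim: m => [|m [IH1 IH2]]; first by (cbn [Nat.add pell fst snd]; lia).
have -> : (S m + n = S (m + n))%nat by [].
by case: (pellS D r (m + n)) => -> ->; case: (pellS D r m) => -> ->; rewrite IH1 IH2; split; ring.
Qed.

Hypothesis hr : r * r = D + 1.

Lemma pell_double m : pellA D r (m + m) = 2 * (pellA D r m * pellA D r m) - 1 /\
  pellB D r (m + m) = 2 * pellA D r m * pellB D r m.
Proof.
have [-> ->] := pell_add m m; have := pell_norm D r m hr.
by move=> h; split; lia.
Qed.

(** Here a + c sqrt D = (r + sqrt D)^m, whose square has the coefficients A and B. *)
Lemma pell_half m : exists a c, [/\ a * a - D * (c * c) = 1,
  pellA D r m = a * a + D * (c * c) & pellB D r m = 2 * a * c].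
Proof.
elim: m => [|m [a [c [h hA hB]]]]; first by exists 1, 0; split; cbn [pell fst snd]; ring.
exists (r * a + D * c), (a + r * c).
case: (pellS D r m) => -> ->; rewrite hA hB; split.
- transitivity ((r * r - D) * (a * a - D * (c * c))); first by ring.
  by rewrite hr h; ring.
- have -> : (r * a + D * c) * (r * a + D * c) + D * ((a + r * c) * (a + r * c)) =
    (2 * D + 1) * (a * a + D * (c * c)) + 2 * r * D * (2 * a * c) +
    (r * r - (D + 1)) * (a * a + D * (c * c)) by ring.
  by rewrite hr; ring.
- have -> : 2 * (r * a + D * c) * (a + r * c) =
    2 * r * (a * a + D * (c * c)) + (2 * D + 1) * (2 * a * c) +
    (r * r - (D + 1)) * (2 * a * c) by ring.
  by rewrite hr; ring.
Qed.

(** At an odd multiple of i, A is an odd Chebyshev polynomial in its value at i. *)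
Lemma pell_odd_multiple i k : (pellA D r i | pellA D r (i + k * (i + i))).
Proof.
elim: k => [|k [q IH]]; first by rewrite Nat.add_0_r; apply: Z.divide_refl.
have -> : (i + S k * (i + i) = (i + k * (i + i)) + (i + i))%nat by lia.
have [-> _] := pell_add (i + k * (i + i)) (i + i).
have [-> ->] := pell_double i; rewrite IH.
exists (q * (2 * (pellA D r i * pellA D r i) - 1) +
  D * pellB D r (i + k * (i + i)) * (2 * pellB D r i)).
ring.
Qed.

Lemma pell_triple i :
  pellA D r (i + (i + i)) = 4 * (pellA D r i * pellA D r i * pellA D r i) - 3 * pellA D r i.
Proof.
have [-> _] := pell_add i (i + i); have [-> ->] := pell_double i.
have := pell_norm D r i hr; set A := pellA D r i; set B := pellB D r i => h.
have -> : D * B * (2 * A * B) = 2 * A * (D * (B * B)) by ring.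
have -> : D * (B * B) = A * A - 1 by lia.
ring.
Qed.

End Divisibility.

Lemma pell_period D r n p m : (p | pellA D r n - 1) -> (p | pellB D r n) ->
  (p | pellA D r (m + n) - pellA D r m) /\ (p | pellB D r (m + n) - pellB D r m).
Proof.
move=> [k hk] [l hl]; have [-> ->] := pell_add D r m n.
have -> : pellA D r n = 1 + k * p by lia.
rewrite hl; split.
- by exists (pellA D r m * k + D * pellB D r m * l); ring.
- by exists (pellA D r m * l + pellB D r m * k); ring.
Qed.

Lemma odd_part m : (m <> 0)%nat -> exists s k, m = (2 ^ s * (2 * k + 1))%nat.
Proof.
elim: m {-2}m (Nat.le_refl m) => [|n IH] m hm m0; first by lia.
have [[k E]|[k E]] := Nat.Even_or_Odd m; last by (exists O, k; rewrite Nat.pow_0_r; lia).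
have [||s [k' E']] := IH k; try lia.
by exists (S s), k'; rewrite E E' /=; lia.
Qed.

(** Let v = A_i, A = A_m and B = B_m.  Modulo v, which divides A, b C B^2 = -1 and
    z = C B, hence b C w^2 = b d z^2 - b d + b C = b C - b d - d C.  Multiplying by
    b C B^2 = -1 gives the square of X = b C B w. *)
Lemma obstruction_square b C r d e w z dl m i : r * r = b * C + 1 ->
  C * e + 1 = z * z -> d * e + 1 = w * w ->
  z = dl * pellA (b * C) r m + C * pellB (b * C) r m ->
  (pellA (b * C) r i | pellA (b * C) r m) ->
  exists X, (pellA (b * C) r i | X * X + (b * C - b * d - d * C)).
Proof.
move=> hr hz hw zm [q hq].
have hn := pell_norm (b * C) r m hr.
move: zm hn; set B := pellB (b * C) r m; rewrite hq; set v := pellA _ _ i => zm hn.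
exists (b * C * B * w).
have hBB : b * C * (B * B) = q * v * (q * v) - 1 by lia.
have hww : b * C * (w * w) = b * d * (z * z) - b * d + b * C by rewrite -hw -hz; ring.
have hzz : z * z = v * (dl * dl * q * q * v + 2 * dl * q * C * B) + C * C * (B * B).
  by rewrite zm; ring.
have E : b * C * B * w * (b * C * B * w) =
  (q * v * (q * v) - 1) * (b * d * (v * (dl * dl * q * q * v + 2 * dl * q * C * B)) +
    d * C * (q * v * (q * v) - 1) - b * d + b * C).
  transitivity (b * C * (B * B) * (b * C * (w * w))); first by ring.
  rewrite hww hzz hBB -{3}hBB; ring.
rewrite E.
exists (q * q * v * (b * d * (v * (dl * dl * q * q * v + 2 * dl * q * C * B)) +
    d * C * (q * v * (q * v) - 1) - b * d + b * C) - 
    (b * d * (dl * dl * q * q * v + 2 * dl * q * C * B) + d * C * q * q * v)).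
ring.
Qed.

(** With b = 3 and d = 8, the number 3 * 13 * 4^2 is a square modulo v = A_(2^s),
    where m is 2^s times an odd number.  All these v are 97 modulo 156 = 12 * 13 (the
    start 721 is, and 2 * 97^2 - 1 is 97 again), so that v is 6, a nonresidue,
    modulo 13. *)
Lemma no_extension_8_120 e z dl m : m <> O ->
  120 * e + 1 = z * z -> Zsquare (8 * e + 1) ->
  z = dl * pellA (3 * 120) 19 m + 120 * pellB (3 * 120) 19 m -> False.
Proof.
move=> m0 hz [w hw] zm.
have [s [k E]] := odd_part m m0.
have hr : 19 * 19 = 3 * 120 + 1 by [].
have hdiv : (pellA (3 * 120) 19 (2 ^ s) | pellA (3 * 120) 19 m).
  have -> : (m = 2 ^ s + k * (2 ^ s + 2 ^ s))%nat by rewrite E; lia.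
  exact: pell_odd_multiple.
have [X hX] := obstruction_square 3 120 19 8 e w z dl m (2 ^ s) hr hz hw zm hdiv.
have [q hq] : exists q, pellA (3 * 120) 19 (2 ^ s) = 97 + 156 * q.
  elim: s {E hdiv hX} => [|s [q IH]]; first by exists 4.
  have -> : (2 ^ S s = 2 ^ s + 2 ^ s)%nat by rewrite /=; lia.
  have [-> _] := pell_double (3 * 120) 19 hr (2 ^ s).
  by rewrite IH; exists (2 * 2 * 97 * q + 2 * 156 * q * q + 120); ring.
have [v0 _] := pell_pos (3 * 120) 19 (ltac:(lia)) (ltac:(lia)) hr (2 ^ s).
have [] := @jacobi_residue 13%nat 3%nat (pellA (3 * 120) 19 (2 ^ s)) X 4 3 erefl erefl (ltac:(lia)).
- have -> : pellA (3 * 120) 19 (2 ^ s) = 1 + (8 + 13 * q) * 12 by rewrite hq; ring.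
  by rewrite Z.mod_add.
- by right; right; left.
- by rewrite hq; exists (- (69 + 111 * q)), 37; ring.
- have -> : X * X - 3 * Z.of_nat 13%nat * (4 * 4) = X * X + (3 * 120 - 3 * 8 - 8 * 120) by ring.
  exact: hX.
move=> u; rewrite hq.
have -> : 2 * Z.of_nat 3%nat = 6 by [].
have -> : (97 + 156 * q) ^ 6 = 97 ^ 6 + 13 * (12 * q * (6 * 97 ^ 5 +
    15 * 97 ^ 4 * (156 * q) + 20 * 97 ^ 3 * (156 * q) ^ 2 + 15 * 97 ^ 2 * (156 * q) ^ 3 +
    6 * 97 * (156 * q) ^ 4 + (156 * q) ^ 5)) by ring.
by lia.
Qed.

Lemma mod0P p x : 0 < p -> reflect (p | x) (x mod p =? 0).
Proof.
move=> p0; apply: (iffP idP) => [/Z.eqb_eq|] h; last apply/Z.eqb_eq.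
- by apply/Z.mod_divide; [lia | exact: h].
- by apply/Z.mod_divide; [lia | exact: h].
Qed.

(** If 120 e + 1 = x^2, e + 1 = u^2 and 3 e + 1 = w^2, then 120 u^2 = x^2 + 119 and
    40 w^2 = x^2 + 39. *)
Definition locally_soluble (p x : Z) : bool :=
  let l := List.map Z.of_nat (List.seq 0 (Z.to_nat p)) in
  List.existsb (fun u => (120 * (u * u) - (x * x + 119)) mod p =? 0) l &&
  List.existsb (fun w => (40 * (w * w) - (x * x + 39)) mod p =? 0) l.

Lemma locally_solubleP p x y u w : 0 < p -> y mod p = x mod p ->
  120 * (u * u) = y * y + 119 -> 40 * (w * w) = y * y + 39 -> locally_soluble p x.
Proof.
move=> p0 hyx hu hw.
have mem t : List.In (t mod p) (List.map Z.of_nat (List.seq 0 (Z.to_nat p))).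
  apply/List.in_map_iff; exists (Z.to_nat (t mod p)).
  have := Z.mod_pos_bound t p p0; rewrite List.in_seq; lia.
have E c t k : c * (t * t) = y * y + k -> (c * (t mod p * (t mod p)) - (x * x + k)) mod p =? 0.
  move=> h; apply/(mod0P _ _ p0).
  have ht := Z.div_mod t p (ltac:(lia)).
  have [q hq] : (p | y - x).
    by apply/(mod0P _ _ p0); rewrite Zminus_mod hyx Z.sub_diag Z.mod_0_l //; lia.
  exists (c * ((t / p) * (t / p)) * p - 2 * c * t * (t / p) + q * (y + x)).
  have ht' : t mod p = t - p * (t / p) by lia.
  rewrite ht'.
  have : (y + x) * (y - x) = (y + x) * (q * p) by rewrite hq.
  by lia.
rewrite /locally_soluble; apply/andP; split; apply/List.existsb_exists.
- by exists (u mod p); split; [exact: mem | apply: E].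
- by exists (w mod p); split; [exact: mem | apply: E].
Qed.

Lemma period9 p : List.In p (13 :: 71 :: 379 :: nil)%list ->
  (p | pellA 201600 449 9 - 1) /\ (p | pellB 201600 449 9).
Proof.
by move=> [<-|[<-|[<-|[]]]]; split; apply/mod0P.
Qed.

(** Modulo 13, 71 and 379 the unit (449 + sqrt 201600)^2 has order dividing 9
    ([period9]), so that each of these primes tests the class of the index modulo 9;
    together they eliminate the eight nonzero classes. *)
Lemma sieve9 : List.forallb (fun j => List.forallb (fun dl =>
    ~~ List.forallb (fun p => locally_soluble p (pellA 201600 449 j + dl * 120 * pellB 201600 449 j))
         (13 :: 71 :: 379 :: nil)%list) (1 :: -1 :: nil)%list) (List.seq 1 8).
Proof. by vm_compute. Qed.

Lemma index_mod9 m dl y u w : dl = 1 \/ dl = -1 ->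
  y = pellA 201600 449 m + dl * 120 * pellB 201600 449 m ->
  120 * (u * u) = y * y + 119 -> 40 * (w * w) = y * y + 39 ->
  exists k, m = (9 * k)%nat.
Proof.
move=> hdl hy hu hw.
have E := Nat.div_mod_eq m 9; set k := (m / 9)%nat in E; set j := (m mod 9)%nat in E.
have j9 : Nat.lt j 9 by apply: Nat.mod_upper_bound.
exists k; suff : j = O by lia.
case: (Nat.eq_dec j 0) => // j0; exfalso.
have := sieve9; move/List.forallb_forall => /(_ j).
have jin : List.In j (List.seq 1 8) by apply/List.in_seq; lia.
move/(_ jin)/List.forallb_forall => /(_ dl).
have dlin : List.In dl (1 :: -1 :: nil)%list by case: hdl => ->; [left | right; left].
move/(_ dlin)/negP; apply; apply/List.forallb_forall => p hp.
have [h1 h2] := period9 p hp.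
have p0 : 0 < p by case: hp => [|[|[|[]]]] <-.
apply: (locally_solubleP p _ y u w p0 _ hu hw).
have {}E : m = (j + k * 9)%nat by lia.
have [[a ha] [c hc]] : (p | pellA 201600 449 m - pellA 201600 449 j) /\
    (p | pellB 201600 449 m - pellB 201600 449 j).
  rewrite E; elim: (k) => [|i [[a IH1] [c IH2]]].
    by rewrite Nat.add_0_r !Z.sub_diag; split; apply: Z.divide_0_r.
  have -> : (j + S i * 9 = (j + i * 9) + 9)%nat by lia.
  have [[a' h1'] [c' h2']] := pell_period 201600 449 9 p (j + i * 9) h1 h2.
  by split; [exists (a + a') | exists (c + c')]; lia.
rewrite hy.
have -> : pellA 201600 449 m + dl * 120 * pellB 201600 449 m =
  pellA 201600 449 j + dl * 120 * pellB 201600 449 j + (a + dl * 120 * c) * p by lia.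
by rewrite Z.mod_add //; lia.
Qed.

(** The residues modulo 109 of A_(2^s): the orbit of A_1 = 10 under
    x -> 2 x^2 - 1. *)
Definition orbit109 : list Z := (10 :: 90 :: 67 :: 39 :: 98 :: 23 :: 76 :: 106 :: 17 :: 32 ::
  85 :: 61 :: 29 :: 46 :: 89 :: 36 :: 84 :: 50 :: 94 :: 13 :: nil)%list.

Lemma pell_orbit109 s : List.In (pellA 201600 449 (2 ^ s) mod 109) orbit109.
Proof.
elim: s => [|s IH]; first by left.
have -> : (2 ^ S s = 2 ^ s + 2 ^ s)%nat by rewrite Nat.pow_succ_r'; lia.
have [-> _] := pell_double 201600 449 (erefl _) (2 ^ s).
move: IH; set x := pellA _ _ _ => IH.
have -> : (2 * (x * x) - 1) mod 109 = (2 * ((x mod 109) * (x mod 109)) - 1) mod 109.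
  by rewrite (Zminus_mod (2 * (x * x))) (Zmult_mod 2) (Zmult_mod x) -Zmult_mod -Zminus_mod.
have : List.forallb (fun y => List.existsb (Z.eqb ((2 * (y * y) - 1) mod 109)) orbit109) orbit109 by [].
move/List.forallb_forall/(_ _ IH)/List.existsb_exists => [z [hz /Z.eqb_eq ->]].
exact: hz.
Qed.

(** The effect on A_i of tripling the index i. *)
Definition triple109 (x : Z) : Z := (4 * (x * x * x) - 3 * x) mod 109.

Lemma pell_triple109 i : pellA 201600 449 (i + (i + i)) mod 109 = triple109 (pellA 201600 449 i mod 109).
Proof.
rewrite pell_triple //; set x := pellA _ _ _; rewrite /triple109.
have E := Z.div_mod x 109 (ltac:(lia)).
set y := x mod 109 in E *; set q := x / 109 in E; rewrite E.
have -> : 4 * ((109 * q + y) * (109 * q + y) * (109 * q + y)) - 3 * (109 * q + y) =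
  4 * (y * y * y) - 3 * y +
  (4 * (109 * 109 * q * q * q + 3 * 109 * q * q * y + 3 * q * y * y) - 3 * q) * 109 by ring.
by rewrite Z.mod_add.
Qed.

(** For i a power of 2, A_i need not be a nonresidue, but one of A_i, A_(3 i), A_(9 i)
    is; all three divide A_m when the odd multiple m of i is divisible by 9. *)
Lemma nonresidue109 x : List.In x orbit109 ->
  exists n, (n = 0 \/ n = 1 \/ n = 2)%nat /\ (Nat.iter n triple109 x) ^ 54 mod 109 = 108.
Proof.
move=> hx.
have : List.forallb (fun x => List.existsb
   (fun n => (Nat.iter n triple109 x) ^ 54 mod 109 =? 108) (0 :: 1 :: 2 :: nil)%nat) orbit109 by vm_compute.
move/List.forallb_forall/(_ _ hx)/List.existsb_exists => [n [hn /Z.eqb_eq h]].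
by exists n; split => //; case: hn => [<-|[<-|[<-|[]]]]; [left | right; left | right; right].
Qed.

Lemma nonresidue_index m : m <> O -> (exists n, m = (9 * n)%nat) ->
  exists i, (pellA 201600 449 i | pellA 201600 449 m) /\ pellA 201600 449 i ^ 54 mod 109 = 108.
Proof.
move=> m0 [n mn].
have [s [k E]] := odd_part n (ltac:(lia)).
have [c [hc hnr]] := nonresidue109 _ (pell_orbit109 s).
have tr i l : (m = i * (2 * l + 1))%nat -> (pellA 201600 449 i | pellA 201600 449 m).
  move=> ->; have -> : (i * (2 * l + 1) = i + l * (i + i))%nat by lia.
  exact: pell_odd_multiple.
case: hc hnr => [->|[->|->]]; rewrite /Nat.iter; cbn [nat_rect].
- move=> h; exists (2 ^ s)%nat; split; last by rewrite Zpower_mod.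
  by apply: (tr _ (9 * k + 4)%nat); rewrite mn E; lia.
- rewrite -pell_triple109 => h; exists (2 ^ s + (2 ^ s + 2 ^ s))%nat.
  split; last by rewrite Zpower_mod.
  by apply: (tr _ (3 * k + 1)%nat); rewrite mn E; lia.
- rewrite -!pell_triple109 => h.
  exists ((2 ^ s + (2 ^ s + 2 ^ s)) + ((2 ^ s + (2 ^ s + 2 ^ s)) + (2 ^ s + (2 ^ s + 2 ^ s))))%nat.
  split; last by rewrite Zpower_mod.
  by apply: (tr _ k); rewrite mn E; lia.
Qed.

Lemma coprime109 v h : v = 1 + 30 * h -> v ^ 54 mod 109 = 108 ->
  exists u w, u * (109 * 30) + w * v = 1.
Proof.
move=> hv1 hmod.
have [f hf] : exists f, v ^ 54 = v * f.
  by exists (v ^ 53); rewrite -(Z.pow_succ_r v 53).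
have hv := Z.div_mod (v ^ 54) 109 (ltac:(lia)).
rewrite hmod hf in hv.
move: (v * f / 109) hv => g hv.
(* from 109 (g + 1) - v f = 1, with the first term multiplied by v - 30 h = 1 *)
exists (- ((g + 1) * h)), (109 * (g + 1) - f).
have e1 : 109 * (g + 1) - v * f = 1 by clear - hv; lia.
have e2 : v - 30 * h = 1 by clear - hv1; lia.
transitivity ((109 * (g + 1)) * (v - 30 * h) - v * f); first by ring.
by rewrite e2; clear - e1; lia.
Qed.

(** Modulo v, X^2 = -2 * 109 * 30^2 and 2 a^2 = 1, since 2 a^2 = v + 1.  Hence
    (a X)^2 = -109 * 30^2: passing from X to a X removes the factor 2. *)
Lemma obstruction109 v a b X : 0 < v -> a * a - 201600 * (b * b) = 1 ->
  v = a * a + 201600 * (b * b) -> v ^ 54 mod 109 = 108 ->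
  (v | X * X + (120 * 1680 - 120 * 3 - 3 * 1680)) -> False.
Proof.
move=> v0 ab hA hmod [q hX].
have hv0 : v = 1 + 403200 * (b * b) by clear - ab hA; lia.
have [] := @jacobi_residue 109%nat 27%nat v (a * X) 30 (-1) erefl erefl v0.
- have -> : v = 1 + (33600 * (b * b)) * 12 by clear - hv0; lia.
  by rewrite Z.mod_add.
- by right; left.
- apply: (coprime109 v (13440 * (b * b))) => //.
  by clear - hv0; lia.
- exists (q * (a * a) - 98100).
  have hv : 2 * (a * a) = v + 1 by clear - hA ab; lia.
  have -> : a * X * (a * X) - -1 * Z.of_nat 109%nat * (30 * 30) =
     (a * a) * (X * X) + 98100 by ring.
  have -> : X * X = q * v - (201600 - 120 * 3 - 3 * 1680) by clear - hX; lia.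
  have -> : (a * a) * (q * v - (201600 - 120 * 3 - 3 * 1680)) =
     (a * a) * q * v - 98100 * (2 * (a * a)) by ring.
  by rewrite hv; ring.
move=> l.
have -> : 2 * Z.of_nat 27%nat = 54 by [].
have -> : Z.of_nat 109%nat = 109 by [].
move=> hl.
have {}hl : v ^ 54 = 1 + l * 109 by clear - hl; lia.
by move: hmod; rewrite hl Z.mod_add.
Qed.

(** This is [obstruction_square] with b = 120 and d = 3, at an i such that m is an
    odd multiple of i and A_i is a nonresidue modulo 109. *)
Lemma no_extension_120_1680 e z dl m : m <> O -> dl = 1 \/ dl = -1 ->
  1680 * e + 1 = z * z -> Zsquare (1 * e + 1) -> Zsquare (3 * e + 1) ->
  z = dl * pellA (120 * 1680) 449 m + 1680 * pellB (120 * 1680) 449 m ->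
  120 * e + 1 = (pellA (120 * 1680) 449 m + dl * 120 * pellB (120 * 1680) 449 m) *
                (pellA (120 * 1680) 449 m + dl * 120 * pellB (120 * 1680) 449 m) -> False.
Proof.
move=> m0 hdl hz [u hu] [w hw] zm.
have hr : 449 * 449 = 120 * 1680 + 1 by [].
have ob i := obstruction_square 120 1680 449 3 e w z dl m i hr hz hw zm.
move: ob {hr zm}; have -> : 120 * 1680 = 201600 by [].
move=> ob ye.
have [n mn] : exists n, m = (9 * n)%nat.
  by apply: (index_mod9 m dl _ u w hdl erefl); lia.
have [i [hdiv hmod]] := nonresidue_index m m0 (ex_intro _ n mn).
have [X hX] := ob i hdiv.
have [a [b [ab hA _]]] := pell_half 201600 449 (erefl _) i.
have [v0 _] := pell_pos 201600 449 (ltac:(lia)) (ltac:(lia)) (erefl _) i.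
apply: (obstruction109 _ a b X _ ab hA hmod hX); lia.
Qed.


End SmallQuintuples.


(** * Partial fractions with integral, small coefficients *)
Section PartialFractions.
Local Set Implicit Arguments.
Local Unset Strict Implicit.
Local Unset Printing Implicit Defensive.
Import all_boot all_order all_algebra.
Import mathcomp.zify.zify mathcomp.algebra_tactics.ring mathcomp.algebra_tactics.lra.
Import Order.TTheory GRing.Theory Num.Theory.
Local Open Scope ring_scope.

Section PartialFractions.
Variable F : fieldType.
Implicit Types (p q : {poly F}) (d y b : F) (n : nat).

(** The difference of the two sides is divisible by q0 q1 q2, which has a larger
    degree. *)
Lemma partial_fractions3 n (P q0 q1 q2 R0 R1 R2 : {poly F}) :
  size q0 = n.+1 -> size q1 = n.+1 -> size q2 = n.+1 ->
  (size P <= 3 * n)%N -> (size R0 <= n)%N -> (size R1 <= n)%N -> (size R2 <= n)%N ->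
  coprimep q0 q1 -> coprimep q0 q2 -> coprimep q1 q2 ->
  q0 %| P - R0 * (q1 * q2) -> q1 %| P - R1 * (q0 * q2) -> q2 %| P - R2 * (q0 * q1) ->
  P = R0 * (q1 * q2) + R1 * (q0 * q2) + R2 * (q0 * q1).
Proof.
move=> s0 s1 s2 sP sR0 sR1 sR2 c01 c02 c12 d0 d1 d2.
set E := R0 * (q1 * q2) + _ + _.
apply/eqP; rewrite -subr_eq0 -[_ == 0]negbK; apply/negP => nz.
have q01 : q0 * q1 * q2 %| P - E.
  rewrite !Gauss_dvdp ?coprimepMl ?c01 ?c02 ?c12 //; apply/andP; split; last first.
    have -> : P - E = (P - R2 * (q0 * q1)) - q2 * (R0 * q1 + R1 * q0) by rewrite /E; ring.
    by rewrite dvdp_sub // dvdp_mulr.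
  apply/andP; split.
    have -> : P - E = (P - R0 * (q1 * q2)) - q0 * (R1 * q2 + R2 * q1) by rewrite /E; ring.
    by rewrite dvdp_sub // dvdp_mulr.
  have -> : P - E = (P - R1 * (q0 * q2)) - q1 * (R0 * q2 + R2 * q0) by rewrite /E; ring.
  by rewrite dvdp_sub // dvdp_mulr.
have := dvdp_leq nz q01.
have n0 (q : {poly F}) : size q = n.+1 -> q != 0 by rewrite -size_poly_gt0 => ->.
rewrite !size_mul ?mulf_neq0 ?n0 // s0 s1 s2.
have sz (R q q' : {poly F}) : (size R <= n)%N -> size q = n.+1 -> size q' = n.+1 ->
    (size (R * (q * q'))%R <= 3 * n)%N.
  move=> hR hq hq'; have := size_polyMleq R (q * q'); have := size_polyMleq q q'.
  by rewrite hq hq'; move: (size (R * (q * q'))%R) (size (q * q')%R) => a c; lia.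
have : (size (P - E)%R <= 3 * n)%N.
  apply: leq_trans (size_polyD _ _) _; rewrite size_polyN geq_max sP /=.
  apply: leq_trans (size_polyD _ _) _; rewrite geq_max sz // andbT.
  by apply: leq_trans (size_polyD _ _) _; rewrite geq_max !sz.
by move: (size (P - E)%R) => a; lia.
Qed.

(** The inverse of 1 + c X modulo X^n. *)
Definition geom n (c : F) : {poly F} := \poly_(h < n) (- c) ^+ h.

Definition inverse_mod n p q := 'X^n %| p * q - 1.

Lemma geomP n c : inverse_mod n ('X * c%:P + 1) (geom n c).
Proof.
rewrite /inverse_mod; have -> : ('X * c%:P + 1) * geom n c - 1 = - ((- c) ^+ n *: 'X^n).
  elim: n => [|n IH]; rewrite /geom.
    by rewrite poly_def big_ord0 mulr0 !expr0 scale1r sub0r.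
  rewrite poly_def big_ord_recr /= -poly_def mulrDr addrAC.
  rewrite -/(geom n c) IH -!mul_polyC !exprS polyCM polyCN; ring.
by rewrite -mul_polyC -mulNr dvdp_mull.
Qed.

Lemma inverse_modM n p p' q q' :
  inverse_mod n p q -> inverse_mod n p' q' -> inverse_mod n (p * p') (q * q').
Proof.
rewrite /inverse_mod => h h'.
have -> : p * p' * (q * q') - 1 = (p * q) * (p' * q' - 1) + (p * q - 1) by ring.
by rewrite dvdp_add // dvdp_mull.
Qed.

Lemma inverse_modX n p q k : inverse_mod n p q -> inverse_mod n (p ^+ k) (q ^+ k).
Proof.
move=> h; elim: k => [|k IH]; first by rewrite /inverse_mod !expr0 mulr1 subrr dvdp0.
by rewrite !exprS; apply: inverse_modM.
Qed.

Lemma inverse_mod_linear n d : d != 0 ->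
  inverse_mod n ('X + d%:P) (d^-1 *: geom n d^-1).
Proof.
move=> d0; have -> : 'X + d%:P = d *: ('X * (d^-1)%:P + 1).
  by rewrite -mul_polyC mulrDr mulr1 mulrCA -polyCM divff // mulr1.
rewrite /inverse_mod -scalerAl -scalerAr scalerA divff // scale1r.
exact: geomP.
Qed.

(** The inverse of (X + d)^n (X + d')^n modulo X^n, see [cofactorP]. *)
Definition cofactor n d d' : {poly F} :=
  (d * d') ^- n *: (geom n d^-1 ^+ n * geom n d'^-1 ^+ n).

Lemma cofactorP n d d' : d != 0 -> d' != 0 ->
  inverse_mod n (('X + d%:P) ^+ n * ('X + d'%:P) ^+ n) (cofactor n d d').
Proof.
move=> d0 d0'; have -> : cofactor n d d' = (d^-1 *: geom n d^-1) ^+ n * (d'^-1 *: geom n d'^-1) ^+ n.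
  by rewrite !exprZn -scalerAl -scalerAr scalerA /cofactor exprMn invfM !exprVn.
by apply: inverse_modM; apply: inverse_modX; apply: inverse_mod_linear.
Qed.

(** For a pole b, with y = N - b and other poles b - d, b - d': the Taylor polynomial
    at b, in powers of u - b, of (u - N)^n / ((u - b + d)^n (u - b + d')^n). *)
Definition principal_part n y d d' : {poly F} :=
  take_poly n (('X - y%:P) ^+ n * cofactor n d d').

Lemma principal_partP n y d d' : d != 0 -> d' != 0 ->
  'X^n %| ('X - y%:P) ^+ n - principal_part n y d d' * (('X + d%:P) ^+ n * ('X + d'%:P) ^+ n).
Proof.
move=> d0 d0'; have := cofactorP n d0 d0'; rewrite /inverse_mod.
set Q := ('X + d%:P) ^+ n * _; set S := cofactor n d d'; set T := ('X - y%:P) ^+ n => h.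
have -> : principal_part n y d d' = T * S - drop_poly n (T * S) * 'X^n.
  by rewrite -{1}[T * S](poly_take_drop n) addrK.
have -> : T - (T * S - drop_poly n (T * S) * 'X^n) * Q =
  (- T) * (Q * S - 1) + (drop_poly n (T * S) * Q) * 'X^n by ring.
by rewrite dvdp_add // dvdp_mull.
Qed.

Lemma principal_part_comp n N b b' b'' : b != b' -> b != b'' ->
  ('X - b%:P) ^+ n %| ('X - N%:P) ^+ n -
     (principal_part n (N - b) (b - b') (b - b'') \Po ('X - b%:P)) *
       (('X - b'%:P) ^+ n * ('X - b''%:P) ^+ n).
Proof.
move=> hb hb'; rewrite -subr_eq0 in hb; rewrite -subr_eq0 in hb'.
have /dvdpP [H hH] := principal_partP n (N - b) hb hb'.
apply/dvdpP; exists (H \Po ('X - b%:P)).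
have := congr1 (fun p => p \Po ('X - b%:P)) hH.
rewrite !(rmorphB, rmorphM, rmorphXn, rmorphD) /= !comp_polyX !comp_polyC => <-.
congr (_ - _ * (_ * _)); congr (_ ^+ _); rewrite ?rmorphB; ring.
Qed.

Lemma partial_fractions_eval n N b0 b1 b2 u : (0 < n)%N -> b0 != b1 -> b0 != b2 -> b1 != b2 ->
  u != b0 -> u != b1 -> u != b2 -> 
  (u - N) ^+ n / ((u - b0) ^+ n * (u - b1) ^+ n * (u - b2) ^+ n) =
  \sum_(i < n) (principal_part n (N - b0) (b0 - b1) (b0 - b2))`_i / (u - b0) ^+ (n - i) +
  \sum_(i < n) (principal_part n (N - b1) (b1 - b0) (b1 - b2))`_i / (u - b1) ^+ (n - i) +
  \sum_(i < n) (principal_part n (N - b2) (b2 - b0) (b2 - b1))`_i / (u - b2) ^+ (n - i).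
Proof.
move=> n0 b01 b02 b12 u0 u1 u2.
set R0 := principal_part _ (N - b0) _ _; set R1 := principal_part _ (N - b1) _ _.
set R2 := principal_part _ (N - b2) _ _.
have szR (R : {poly F}) b : (size R <= n)%N -> (size (R \Po ('X - b%:P)) <= n)%N.
  by rewrite size_comp_poly2 // size_XsubC.
have szq b : size (('X - b%:P) ^+ n) = n.+1 by rewrite size_exp_XsubC.
have cop b b' : b != b' -> coprimep (('X - b%:P) ^+ n) (('X - b'%:P) ^+ n).
  move=> h; rewrite coprimep_expl // coprimep_expr // coprimep_XsubC root_XsubC.
  by rewrite eq_sym.
have b10 : b1 != b0 by rewrite eq_sym.
have b20 : b2 != b0 by rewrite eq_sym.
have b21 : b2 != b1 by rewrite eq_sym.
have szN : (size (('X - N%:P) ^+ n)%R <= 3 * n)%N by rewrite size_exp_XsubC; lia.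
have E := partial_fractions3 (szq b0) (szq b1) (szq b2) szN (szR R0 b0 (size_take_poly _ _))
  (szR R1 b1 (size_take_poly _ _)) (szR R2 b2 (size_take_poly _ _)) (cop _ _ b01) (cop _ _ b02) (cop _ _ b12)
  (principal_part_comp n N b01 b02) (principal_part_comp n N b10 b12) (principal_part_comp n N b20 b21).
have term (R : {poly F}) b : u != b -> (size R <= n)%N ->
   \sum_(i < n) R`_i / (u - b) ^+ (n - i) = (R \Po ('X - b%:P)).[u] / (u - b) ^+ n.
  move=> ub sR; rewrite horner_comp !hornerE (horner_coef_wide _ sR) mulr_suml.
  apply: eq_bigr => i _; rewrite -mulrA; congr (_ * _).
  have ub0 : u - b != 0 by rewrite subr_eq0.
  have -> : (u - b) ^+ n = (u - b) ^+ i * (u - b) ^+ (n - i) by rewrite -exprD subnKC // ltnW.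
  by rewrite invfM mulrA divff ?mul1r // expf_neq0.
have sub0 b : u != b -> (u - b) ^+ n != 0 by move=> ub; rewrite expf_neq0 // subr_eq0.
rewrite !term ?size_take_poly //.
have := congr1 (horner^~ u) E.
rewrite !(hornerXsubC, horner_exp, hornerM, hornerD) => ->.
move: (sub0 _ u0) (sub0 _ u1) (sub0 _ u2).
move: ((u - b0) ^+ n) ((u - b1) ^+ n) ((u - b2) ^+ n) => q0 q1 q2 h0 h1 h2.
by field; rewrite h0 h1 h2.
Qed.

End PartialFractions.

End PartialFractions.

Section CoefficientBounds.
Local Set Implicit Arguments.
Local Unset Strict Implicit.
Local Unset Printing Implicit Defensive.
Import all_boot all_order all_algebra.
Import mathcomp.zify.zify mathcomp.algebra_tactics.ring mathcomp.algebra_tactics.lra.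
Import Order.TTheory GRing.Theory Num.Theory.
Local Open Scope ring_scope.

Section Coefficients.
Variable F : archiRealFieldType.
Implicit Types (p q P Q : {poly F}) (d y : F) (n : nat).

(** The product of (2 j - 1) / (2 j) for 0 < j <= k; the integral over v > 0 of
    1 / (v^2 + 1)^(k + 1) is PI / 2 times it. *)
Definition wallis (k : nat) : F := 'C(2 * k, k)%:R / 4 ^+ k.

(** Up to the factor PI / 2 * th, where N th^2 = y, the integral over v > 0 of the
    partial fractions at one pole: see [half_line_form]. *)
Definition form_coef n y d d' : F :=
  \sum_(i < n) (principal_part n y d d')`_i * wallis (n.-1 - i) / y ^+ (n - i).

(** In other words p (2 y X) / y^k has integral coefficients.  This holds for X - y
    with k = 1 and, when 2 y / d is an integer, for [geom n d^-1] with k = 0. *)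
Definition scaled_integral y k p :=
  forall i, p`_i * (2 * y) ^+ i / y ^+ k \is a Num.int.

Lemma scaled_integralM y k l p q : scaled_integral y k p -> scaled_integral y l q ->
  scaled_integral y (k + l) (p * q).
Proof.
move=> hp hq i; rewrite coefM !mulr_suml; apply: rpred_sum => j _.
have -> : p`_j * q`_(i - j) * (2 * y) ^+ i / y ^+ (k + l) =
  (p`_j * (2 * y) ^+ j / y ^+ k) * (q`_(i - j) * (2 * y) ^+ (i - j) / y ^+ l).
  have -> : (2 * y) ^+ i = (2 * y) ^+ j * (2 * y) ^+ (i - j).
    by rewrite -exprD subnKC // -ltnS.
  by rewrite exprD invfM; ring.
exact: rpredM.
Qed.

Lemma scaled_integralX y k p m : scaled_integral y k p -> scaled_integral y (m * k) (p ^+ m).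
Proof.
move=> hp; elim: m => [|m IH]; last by rewrite exprS mulSn; apply: scaled_integralM.
move=> i; rewrite expr0 mul0n coef1 divr1; case: i => [|i] /=; last by rewrite mul0r rpred0.
by rewrite expr0 mulr1 rpred1.
Qed.

Lemma scaled_integral_geom y n d : 2 * y / d \is a Num.int ->
  scaled_integral y 0 (geom n d^-1).
Proof.
move=> h i; rewrite /geom coef_poly divr1; case: ifP => _; last by rewrite mul0r rpred0.
have -> : (- d^-1) ^+ i * (2 * y) ^+ i = (- (2 * y / d)) ^+ i by rewrite -exprMn; congr (_ ^+ _); ring.
by rewrite rpredX // rpredN.
Qed.

Lemma scaled_integral_XsubC y : y != 0 -> scaled_integral y 1 ('X - y%:P).
Proof.
move=> y0 [|[|i]]; rewrite coefB coefX coefC /= expr1.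
- by rewrite sub0r expr0 mulr1 mulNr divff // rpredN rpred1.
- by rewrite subr0 mul1r expr1 mulfK //; apply: rpred_nat.
- by rewrite subr0 !mul0r rpred0.
Qed.

(** 24^n = 6^n 4^n.  The factor 6^n absorbs (d d')^n; the factor
    4^n = 2^(i + 2) 4^(n - 1 - i) 2^i absorbs the denominator of [wallis] and
    provides the 2^i of [scaled_integral]. *)
Lemma form_coef_int n y d d' : y != 0 -> d != 0 -> d' != 0 ->
  2 * y / d \is a Num.int -> 2 * y / d' \is a Num.int -> 6 / (d * d') \is a Num.int ->
  24 ^+ n * form_coef n y d d' \is a Num.int.
Proof.
move=> y0 d0 d0' hd hd' hdd; rewrite /form_coef mulr_sumr; apply: rpred_sum => i _.
rewrite /principal_part coef_take_poly ltn_ord /cofactor -scalerAr coefZ.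
set T := ('X - y%:P) ^+ n * _.
have hT : scaled_integral y n T.
  have := scaled_integralM (scaled_integralX n (scaled_integral_XsubC y0))
    (scaled_integralM (scaled_integralX n (scaled_integral_geom n hd))
      (scaled_integralX n (scaled_integral_geom n hd'))).
  by rewrite !muln0 !addn0 muln1.
have dd0 : d * d' != 0 by rewrite mulf_neq0.
have two0 : (2 : F) != 0 by rewrite pnatr_eq0.
have E : 24 ^+ n * ((d * d') ^- n * T`_i * wallis (n.-1 - i) / y ^+ (n - i)) =
  (6 / (d * d')) ^+ n * (T`_i * (2 * y) ^+ i / y ^+ n) * (2 ^+ (i + 2) * 'C(2 * (n.-1 - i), n.-1 - i)%:R).
  have -> : y ^+ n = y ^+ i * y ^+ (n - i) by rewrite -exprD subnKC // ltnW.
  have -> : (24 : F) ^+ n = 6 ^+ n * 2 ^+ (i + 2) * 4 ^+ (n.-1 - i) * 2 ^+ i.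
    have -> : (4 : F) = 2 ^+ 2 by rewrite -natrX.
    rewrite -exprM -!mulrA -!exprD.
    have -> : (i + 2 + (2 * (n.-1 - i) + i) = 2 * n)%N by have := ltn_ord i; lia.
    by rewrite exprM -exprMn; congr (_ ^+ _); ring.
  rewrite /wallis !exprMn exprVn.
  have a0 := expf_neq0 i two0; have a1 := expf_neq0 (n - i) y0; have a2 := expf_neq0 i y0.
  have a3 := expf_neq0 n dd0.
  have a4 : (4 : F) ^+ (n.-1 - i) != 0 by rewrite expf_neq0 // pnatr_eq0.
  move: a0 a1 a2 a3 a4; rewrite [(d * d') ^+ n]exprMn.
  move: (2 ^+ i) (y ^+ (n - i)) (y ^+ i) (d ^+ n * d' ^+ n) (4 ^+ (n.-1 - i)) => A B C D G.
  move=> a0 a1 a2 a3 a4; field.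
  by rewrite ?a0 ?a1 ?a2 ?a3 ?a4.
rewrite E; apply: rpredM; first apply: rpredM.
- exact: rpredX.
- exact: hT.
- by rewrite rpredM // ?rpredX // rpred_nat.
Qed.

(** Majorant polynomials in the sense of Cauchy. *)
Definition dominates P p := forall i, `|p`_i| <= P`_i.

Lemma dominatesM P Q p q : dominates P p -> dominates Q q -> dominates (P * Q) (p * q).
Proof.
move=> hp hq i; rewrite !coefM; apply: le_trans (ler_norm_sum _ _ _) _.
by apply: ler_sum => j _; rewrite normrM ler_pM.
Qed.

Lemma dominatesX P p m : dominates P p -> dominates (P ^+ m) (p ^+ m).
Proof.
move=> h; elim: m => [|m IH]; last by rewrite !exprS; apply: dominatesM.
by move=> i; rewrite !expr0 coef1; case: eqP => _; rewrite ?normr1 ?normr0.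
Qed.

Lemma dominates_sum P p n r : 0 <= r -> dominates P p ->
  \sum_(i < n) `|p`_i| * r ^+ i <= P.[r].
Proof.
move=> r0 h.
have sz : (size P <= n + size P)%N by rewrite leq_addl.
rewrite (horner_coef_wide _ sz) big_split_ord /=.
rewrite -[X in X <= _]addr0; apply: lerD.
  by apply: ler_sum => i _; rewrite ler_wpM2r // exprn_ge0.
by apply: sumr_ge0 => i _; rewrite mulr_ge0 ?exprn_ge0 // (le_trans _ (h _)).
Qed.

Lemma central_binomial k : (k.+1 * 'C(2 * k.+1, k.+1) = 2 * (2 * k + 1) * 'C(2 * k, k))%N.
Proof.
have -> : (2 * k.+1 = (2 * k).+2)%N by lia.
rewrite binS; have -> : 'C((2 * k).+1, k) = 'C((2 * k).+1, k.+1).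
  have h : (k.+1 <= (2 * k).+1)%N by lia.
  by rewrite -(bin_sub h); congr 'C(_, _); lia.
have := mul_bin_diag (2 * k).+1 k; rewrite /= => h.
by rewrite mulnDr -h; lia.
Qed.

Lemma wallisS k : wallis k.+1 = wallis k * ((2 * k%:R + 1) / (2 * k%:R + 2)).
Proof.
rewrite /wallis.
have k1 : (k%:R + 1 : F) != 0 by rewrite natr1 pnatr_eq0.
have h : (k%:R + 1) * 'C(2 * k.+1, k.+1)%:R = 2 * (2 * k%:R + 1) * 'C(2 * k, k)%:R :> F.
  have := congr1 (fun m : nat => m%:R : F) (central_binomial k).
  by rewrite /= !natrM natrD natrM -natr1.
have p4 : (4 : F) ^+ k != 0 by rewrite expf_neq0 // pnatr_eq0.
rewrite exprS.
have -> : 'C(2 * k.+1, k.+1)%:R = 2 * (2 * k%:R + 1) * 'C(2 * k, k)%:R / (k%:R + 1) :> F.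
  by rewrite -h mulrC mulKf.
move: (4 ^+ k) p4 => q p4.
have k2 : 2 * k%:R + 2 != 0 :> F by apply: contra_neq k1 => e; lra.
by field; rewrite p4 k1 k2.
Qed.

Lemma wallis_bounds k : 0 <= wallis k <= 1.
Proof.
rewrite /wallis divr_ge0 ?exprn_ge0 //= ler_pdivrMr ?exprn_gt0 // mul1r -natrX ler_nat.
have -> : (4 ^ k = 2 ^ (2 * k))%N by rewrite expnM.
have := @expnDn 1 1 (2 * k); rewrite addn1 => ->.
rewrite (bigD1 (inord k)) //= inordK ?leq_addr; last by lia.
by rewrite !exp1n !muln1 leq_addr.
Qed.

(** The majorant is a truncated geometric series of ratio at most 1 / 2. *)
Lemma geom_dominated n c r : 0 <= r -> `|c| * r <= 1 / 2 ->
  exists P, dominates P (geom n c) /\ P.[r] <= 2.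
Proof.
move=> r0 hc; exists (\poly_(h < n) `|c| ^+ h); split.
  by move=> i; rewrite /geom !coef_poly; case: ifP => _; rewrite ?normr0 // normrX normrN.
rewrite horner_poly.
have H : \sum_(h < n) `|c| ^+ h * r ^+ h <= 2 - 2 * (1 / 2) ^+ n.
  elim: n => [|n IH]; first by rewrite big_ord0 expr0 mulr1 subrr.
  rewrite big_ord_recr /= -exprMn.
  have : (`|c| * r) ^+ n <= (1 / 2) ^+ n by apply: lerXn2r => //; rewrite nnegrE ?mulr_ge0 //; lra.
  move: IH; rewrite [(1 / 2) ^+ n.+1]exprS; set a := (1 / 2) ^+ n; lra.
apply: le_trans H _; rewrite lerBlDr lerDl mulr_ge0 // exprn_ge0 //.
by rewrite divr_ge0.
Qed.

(** Cauchy's estimate with a radius r of at most half the distances to the other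
    poles: X - y is bounded by r + y, each of the two geometric series by 2, the
    values of [wallis] by 1, and y^(i - n) by r^(i - n). *)
Lemma form_coef_le n y d d' r : 0 < r <= y -> 2 * r <= `|d| -> 2 * r <= `|d'| ->
  `|24 ^+ n * form_coef n y d d'| <= (96 * (1 + y / r) / `|d * d'|) ^+ n.
Proof.
move=> /andP[r0 ry] hd hd'.
have y0 : 0 < y by lra.
have d0 : 0 < `|d| by lra.
have d0' : 0 < `|d'| by lra.
have dd0 : 0 < `|d * d'| by rewrite normrM mulr_gt0.
have half c : 0 < `|c| -> 2 * r <= `|c| -> `|c^-1| * r <= 1 / 2.
  by move=> c0 hc; rewrite normfV mulrC ler_pdivrMr //; lra.
have [P [hP P2]] := geom_dominated n (ltW r0) (half d d0 hd).
have [P' [hP' P2']] := geom_dominated n (ltW r0) (half d' d0' hd').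
have hX : dominates ('X + y%:P) ('X - y%:P).
  move=> i; rewrite coefB coefD coefX coefC; case: i => [|[|i]] /=.
  - by rewrite sub0r add0r normrN gtr0_norm.
  - by rewrite subr0 addr0 normr1.
  - by rewrite subr0 addr0 normr0.
set T := ('X - y%:P) ^+ n * (geom n d^-1 ^+ n * geom n d'^-1 ^+ n).
have hT : dominates (('X + y%:P) ^+ n * (P ^+ n * P' ^+ n)) T.
  by apply: dominatesM; [|apply: dominatesM]; apply: dominatesX.
have := dominates_sum n (ltW r0) hT.
rewrite !(hornerM, horner_exp, hornerD, hornerX, hornerC) => hsum.
have Pr (R : {poly F}) p : dominates R p -> 0 <= R.[r].
  move=> h; rewrite horner_coef; apply: sumr_ge0 => i _.
  by rewrite mulr_ge0 ?exprn_ge0 ?(ltW r0) // (le_trans _ (h _)).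
have hsum2 : \sum_(i < n) `|T`_i| * r ^+ i <= ((r + y) * 4) ^+ n.
  apply: le_trans hsum _; rewrite -!exprMn lerXn2r ?nnegrE ?mulr_ge0 ?(Pr _ _ hP) ?(Pr _ _ hP') //; try lra.
  have := Pr _ _ hP; have := Pr _ _ hP' => p1 p2.
  rewrite ler_pM2l; last lra.
  by apply: le_trans (ler_pM _ _ P2 P2') _; lra.
have E : form_coef n y d d' = (d * d') ^- n * \sum_(i < n) T`_i * wallis (n.-1 - i) / y ^+ (n - i).
  rewrite /form_coef mulr_sumr; apply: eq_bigr => i _.
  by rewrite /principal_part coef_take_poly ltn_ord /cofactor -scalerAr coefZ -/T !mulrA.
have S : `|\sum_(i < n) T`_i * wallis (n.-1 - i) / y ^+ (n - i)| <= r ^- n * ((r + y) * 4) ^+ n.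
  apply: le_trans (ler_norm_sum _ _ _) _.
  have : r ^- n * \sum_(i < n) `|T`_i| * r ^+ i <= r ^- n * ((r + y) * 4) ^+ n.
    by rewrite ler_pM2l // invr_gt0 exprn_gt0.
  apply: le_trans; rewrite mulr_sumr; apply: ler_sum => i _.
  have /andP[w0 w1] := wallis_bounds (n.-1 - i).
  move: (wallis _) w0 w1 => w w0 w1.
  have yi : 0 <= y ^- (n - i) by rewrite invr_ge0 exprn_ge0 // ltW.
  rewrite !normrM (ger0_norm yi) (ger0_norm w0).
  have -> : r ^- n * (`|T`_i| * r ^+ i) = `|T`_i| * (r ^+ (n - i))^-1.
    have -> : r ^+ n = r ^+ i * r ^+ (n - i) by rewrite -exprD subnKC // ltnW.
    have := expf_neq0 i (lt0r_neq0 r0); have := expf_neq0 (n - i) (lt0r_neq0 r0).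
    by move: (r ^+ i) (r ^+ (n - i)) => a b ha hb; field; rewrite ha hb.
  rewrite -mulrA ler_wpM2l // -[X in _ <= X]mul1r ler_pM ?invr_ge0 ?exprn_ge0 ?(ltW y0) //.
  by rewrite lef_pV2 ?posrE ?exprn_gt0 // lerXn2r ?nnegrE ?(ltW y0) ?(ltW r0).
rewrite E normrM normrM normfV !normrX.
apply: le_trans (_ : 24 ^+ n * (`|d * d'| ^- n * (r ^- n * ((r + y) * 4) ^+ n)) <= _).
  by rewrite normr_nat ler_pM2l ?exprn_gt0 // ler_pM2l ?invr_gt0 ?exprn_gt0.
rewrite -!exprVn -!exprMn lerXn2r ?nnegrE //.
- by rewrite !mulr_ge0 ?invr_ge0 ?(ltW r0) //; lra.
- by rewrite !mulr_ge0 ?invr_ge0 ?(ltW r0) ?addr_ge0 ?divr_ge0 ?(ltW r0) ?(ltW y0).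
- rewrite le_eqVlt; apply/orP; left; apply/eqP; field.
  by rewrite !lt0r_neq0.
Qed.

End Coefficients.

End CoefficientBounds.


(** * Integrals over the half line *)
Section HalfLine.
Import Reals Lra Lia ZArith Coquelicot.Coquelicot.
Import ssreflect ssrfun ssrbool.
Local Open Scope R_scope.

Definition half_line_integral (f : R -> R) (l : R) : Prop :=
  (forall A, 0 <= A -> ex_RInt f 0 A) /\ is_lim (fun A => RInt f 0 A) p_infty l.

Lemma near_infinity (P : R -> Prop) M : (forall A, M < A -> P A) -> Rbar_locally' p_infty P.
Proof. by move=> h; exists M. Qed.

Lemma half_line_plus f g l m : half_line_integral f l -> half_line_integral g m ->
  half_line_integral (fun x => f x + g x) (l + m).
Proof.
move=> [ef lf] [eg lg]; split; first by move=> A hA; apply: (ex_RInt_plus f g); auto.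
apply: (is_lim_ext_loc (fun A => RInt f 0 A + RInt g 0 A)).
  apply: (near_infinity _ 0) => A hA; apply: esym; apply: (RInt_plus f g).
    by apply: ef; lra.
  by apply: eg; lra.
exact: (is_lim_plus _ _ _ l m).
Qed.

Lemma half_line_scal f l c : half_line_integral f l -> half_line_integral (fun x => c * f x) (c * l).
Proof.
move=> [ef lf]; split; first by move=> A hA; apply: (ex_RInt_scal f); auto.
apply: (is_lim_ext_loc (fun A => c * RInt f 0 A)).
  apply: (near_infinity _ 0) => A hA; apply: esym; apply: (RInt_scal f).
  by apply: ef; lra.
exact: (is_lim_scal_l _ c p_infty l).
Qed.

Lemma half_line_ext f g l : (forall x, f x = g x) -> half_line_integral f l -> half_line_integral g l.
Proof.
move=> h [ef lf]; split; first by move=> A hA; apply: (ex_RInt_ext f); auto.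
by apply: (is_lim_ext _ _ _ _ _ lf) => A; apply: RInt_ext.
Qed.

Lemma half_line_zero : half_line_integral (fun _ => 0) 0.
Proof.
split; first by move=> A _; apply: ex_RInt_const.
apply: (is_lim_ext (fun _ => 0)); last exact: is_lim_const.
by move=> A; rewrite RInt_const /scal /= /mult /=; lra.
Qed.

Lemma half_line_ge f l M B : half_line_integral f l ->
  (forall A, B <= A -> M <= RInt f 0 A) -> M <= l.
Proof.
move=> [ef lf] h.
apply: (is_lim_le_loc (fun _ => M) (fun A => RInt f 0 A) p_infty M l) => //; last exact: is_lim_const.
by apply: (near_infinity _ B) => A hA; apply: h; lra.
Qed.

Lemma is_lim_atan : is_lim atan p_infty (PI / 2).
Proof.
have h : is_lim (fun x => PI / 2 - atan (/ x)) p_infty (PI / 2 - atan 0).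
  apply: is_lim_minus'; first exact: is_lim_const.
  apply: (is_lim_comp_continuous Rinv atan p_infty 0).
    by apply: (is_lim_inv (fun x => x) p_infty p_infty (is_lim_id _)).
  apply: ex_derive_continuous; exists (/ (1 + 0²)); exact: is_derive_atan.
have E : PI / 2 - atan 0 = PI / 2 by rewrite atan_0; lra.
rewrite E in h; apply: (is_lim_ext_loc _ _ _ _ _ h).
by apply: (near_infinity _ 0) => x x0; rewrite atan_inv //; lra.
Qed.

(** The recursive form of [wallis], which is the one that integration by parts
    produces; [wallisRE] identifies the two. *)
Fixpoint wallisR (k : nat) : R :=
  match k with O => 1 | S k' => wallisR k' * ((2 * INR k' + 1) / (2 * INR k' + 2)) end.

(** The derivative of v / (v^2 + th^2)^(k + 1), which vanishes at 0 and at infinity, is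
    a combination of the integrands for k + 1 and k.  The case k = 0 is the
    arctangent. *)
Lemma half_line_wallis (th : R) (k : nat) : 0 < th ->
  half_line_integral (fun v => / (v ^ 2 + th ^ 2) ^ (S k)) (PI / 2 * (wallisR k * th / (th ^ 2) ^ (S k))).
Proof.
move=> th0.
have pos v : 0 < v ^ 2 + th ^ 2 by have := pow2_ge_0 v; have := pow_lt th 2 th0; lra.
have cont j v : continuous (fun v => / (v ^ 2 + th ^ 2) ^ j) v.
  apply: ex_derive_continuous; auto_derive.
  by have := pow_lt _ j (pos v); cbn [pow]; lra.
have exR j A : ex_RInt (fun v => / (v ^ 2 + th ^ 2) ^ j) 0 A.
  by apply: ex_RInt_continuous => v _; apply: cont.
elim: k => [|k IH]; split; try by (move=> A _; apply: exR).
  have E A : is_RInt (fun v => / (v ^ 2 + th ^ 2) ^ 1) 0 A (atan (A / th) / th).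
    have -> : atan (A / th) / th = minus (atan (A / th) / th) (atan (0 / th) / th).
      by rewrite /minus /plus /opp /= [0 / th]/Rdiv Rmult_0_l atan_0; lra.
    apply: (is_RInt_derive (fun v => atan (v / th) / th)) => v _; last exact: cont.
    auto_derive => //.
    have hv := pos v; field; repeat split; try lra; nra.
  apply: (is_lim_ext (fun A => / th * atan (A / th))).
    by move=> A; rewrite (is_RInt_unique _ _ _ _ (E A)); field; lra.
  have -> : Finite (PI / 2 * (wallisR 0 * th / (th ^ 2) ^ 1)) = Rbar_mult (/ th) (PI / 2).
    by rewrite /=; congr Finite; field; lra.
  apply: is_lim_scal_l.
  apply: (is_lim_comp atan (fun A => A / th) p_infty (PI / 2) p_infty is_lim_atan).
    apply: (is_lim_ext (fun A => / th * A)); first by move=> A; field; lra.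
    have h := is_lim_scal_l (fun A => A) (/ th) p_infty p_infty (is_lim_id _).
    have E' : Rbar_mult (/ th) p_infty = p_infty.
      by rewrite /=; case: Rle_dec => [h1|h1]; [case: Rle_lt_or_eq_dec => h' //|];
         have := Rinv_0_lt_compat _ th0; lra.
    by rewrite E' in h.
  by exists 0.
have E A : is_RInt (fun v => (2 * INR k + 2) * th ^ 2 * / (v ^ 2 + th ^ 2) ^ (S (S k)) -
     (2 * INR k + 1) * / (v ^ 2 + th ^ 2) ^ (S k)) 0 A (A / (A ^ 2 + th ^ 2) ^ (S k)).
  have -> : A / (A ^ 2 + th ^ 2) ^ (S k) =
     minus (A / (A ^ 2 + th ^ 2) ^ (S k)) (0 / (0 ^ 2 + th ^ 2) ^ (S k)).
    by rewrite /minus /plus /opp /= [0 / _]/Rdiv Rmult_0_l; lra.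
  apply: (is_RInt_derive (fun v => v / (v ^ 2 + th ^ 2) ^ (S k))) => v _.
    auto_derive.
      by have := pow_lt _ (S k) (pos v); rewrite /=; lra.
    rewrite -/(INR (S k)) S_INR.
    have Dv := pos v.
    have -> : v * (v * 1) + th * (th * 1) = v ^ 2 + th ^ 2 by ring.
    have -> : th ^ 2 = (v ^ 2 + th ^ 2) - v ^ 2 by ring.
    have -> : v ^ 2 + (v ^ 2 + th ^ 2 - v ^ 2) = v ^ 2 + th ^ 2 by ring.
    have := pow_lt _ k Dv; cbn [pow].
    move: (v * (v * 1) + th * (th * 1)) Dv => D Dv.
    move: (D ^ k) => q q0; field; split; lra.
  apply: continuous_minus; apply: continuous_scal_r; exact: cont.
have lim0 : is_lim (fun A => A / (A ^ 2 + th ^ 2) ^ (S k)) p_infty 0.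
  apply: (is_lim_le_le_loc (fun _ => 0) (fun A => / A)); last first.
  - have -> : Finite 0 = Rbar_inv p_infty by [].
    by apply: is_lim_inv; first exact: is_lim_id.
  - exact: is_lim_const.
  apply: (near_infinity _ 1) => A A1.
  have A0 : 0 < A by lra.
  have h1 : A ^ 2 <= (A ^ 2 + th ^ 2) ^ (S k).
    have h2 : A ^ 2 <= A ^ 2 + th ^ 2 by have := pow2_ge_0 th; lra.
    have h3 : 1 <= (A ^ 2 + th ^ 2) ^ k by apply: pow_R1_Rle; nra.
    have -> : (A ^ 2 + th ^ 2) ^ (S k) = (A ^ 2 + th ^ 2) * (A ^ 2 + th ^ 2) ^ k by [].
    move: h2 h3 (pow2_ge_0 A) {E}; move: (A ^ 2) (A ^ 2 + th ^ 2) => a D; move: (D ^ k) => q; nra.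
  have h4 : 0 < A ^ 2 by apply: pow_lt.
  split; first by apply: Rlt_le; apply: Rdiv_lt_0_compat => //; lra.
  have -> : / A = A / A ^ 2 by field; lra.
  by apply: Rmult_le_compat_l; [lra | apply: Rinv_le_contravar].
have k0 := pos_INR k.
have c0 : (2 * INR k + 2) * th ^ 2 <> 0 by have := pow_lt th 2 th0; nra.
apply: (is_lim_ext_loc (fun A => / ((2 * INR k + 2) * th ^ 2) *
   (A / (A ^ 2 + th ^ 2) ^ (S k) + (2 * INR k + 1) * RInt (fun v => / (v ^ 2 + th ^ 2) ^ (S k)) 0 A))).
  apply: (near_infinity _ 0) => A _.
  set X := RInt (fun v => / (v ^ 2 + th ^ 2) ^ (S (S k))) 0 A; set Y := RInt _ 0 A.
  have e1 : is_RInt (fun v => (2 * INR k + 2) * th ^ 2 * / (v ^ 2 + th ^ 2) ^ (S (S k)) -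
     (2 * INR k + 1) * / (v ^ 2 + th ^ 2) ^ (S k)) 0 A
     ((2 * INR k + 2) * th ^ 2 * X - (2 * INR k + 1) * Y).
    apply: (is_RInt_minus (fun v => (2 * INR k + 2) * th ^ 2 * / (v ^ 2 + th ^ 2) ^ (S (S k)))
      (fun v => (2 * INR k + 1) * / (v ^ 2 + th ^ 2) ^ (S k))).
    - by apply: (is_RInt_scal (fun v => / (v ^ 2 + th ^ 2) ^ (S (S k)))); apply: RInt_correct.
    - by apply: (is_RInt_scal (fun v => / (v ^ 2 + th ^ 2) ^ (S k))); apply: RInt_correct.
  have e2 : (2 * INR k + 2) * th ^ 2 * X - (2 * INR k + 1) * Y = A / (A ^ 2 + th ^ 2) ^ (S k).
    by rewrite -(is_RInt_unique _ _ _ _ (E A)) (is_RInt_unique _ _ _ _ e1).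
  by rewrite -e2; field; split; lra.
have [_ lk] := IH.
have -> : Finite (PI / 2 * (wallisR (S k) * th / (th ^ 2) ^ S (S k))) =
  Rbar_mult (/ ((2 * INR k + 2) * th ^ 2)) (0 + (2 * INR k + 1) * (PI / 2 * (wallisR k * th / (th ^ 2) ^ S k))).
  rewrite /=; congr Finite; have := pow_lt _ k (pow_lt _ 2 th0).
  rewrite /=; move: ((th * (th * 1)) ^ k) => q q0; field; lra.
apply: is_lim_scal_l; apply: is_lim_plus' => //.
exact: (is_lim_scal_l _ (2 * INR k + 1) _ _ lk).
Qed.

End HalfLine.


(** * Linear forms in 1, theta1, theta2 *)
Section LinearForms.
Import Reals ZArith.
Local Set Implicit Arguments.
Local Unset Strict Implicit.
Local Unset Printing Implicit Defensive.
Import all_boot all_order all_algebra.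
Import Rstruct.
Import mathcomp.zify.zify mathcomp.algebra_tactics.ring mathcomp.algebra_tactics.lra.
Import Order.TTheory GRing.Theory Num.Theory.
Local Open Scope ring_scope.
Arguments half_line_integral f%_function_scope l%_ring_scope.
Local Notation RF := RbaseSymbolsImpl_R__canonical__Num_ArchiRealField.

Lemma half_line_sum n (f : 'I_n -> R -> R) (l : 'I_n -> R) :
  (forall i, half_line_integral (f i) (l i)) ->
  half_line_integral (fun v => \sum_(i < n) f i v) (\sum_(i < n) l i).
Proof.
elim: n f l => [|n IH] f l h.
  rewrite big_ord0; apply: half_line_ext half_line_zero => v.
  by rewrite big_ord0.
rewrite big_ord_recr; apply: (half_line_ext _ _ _ _ (half_line_plus _ _ _ _ (IH _ _ _) (h ord_max))).
  by move=> v; rewrite big_ord_recr.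
by move=> i; apply: h.
Qed.

Lemma wallisRE k : wallisR k = wallis RF k.
Proof.
elim: k => [|k IH]; first by rewrite /wallis /= bin0 expr0 divr1.
have -> : wallisR k.+1 = wallisR k * ((2 * k%:R + 1) / (2 * k%:R + 2)) :> RF.
  by rewrite /= INRE.
by rewrite IH wallisS.
Qed.

(** With u = N (v^2 + 1) and a pole b, u - b = N (v^2 + th^2) where N th^2 = N - b. *)
Lemma half_line_form n (N th d d' : RF) : 0 < N -> 0 < th ->
  half_line_integral (fun v => \sum_(i < n) (principal_part n (N * th ^+ 2) d d')`_i /
      (N * (v ^+ 2 + th ^+ 2)) ^+ (n - i))
    (PI / 2 * (th * form_coef n (N * th ^+ 2) d d')).
Proof.
move=> N0 th0; rewrite /form_coef !mulr_sumr; apply: half_line_sum => i.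
have E : (n - i)%N = (n.-1 - i).+1 by have := ltn_ord i; lia.
set c := _`_i.
have th0' : Rlt 0 th by apply/RltP.
have := half_line_scal _ _ (c / N ^+ (n - i)) (half_line_wallis th (n.-1 - i) th0').
rewrite wallisRE.
have nz0 : N ^+ (n - i) != 0 by rewrite expf_neq0 // lt0r_neq0.
have nz1 : (th ^+ 2) ^+ (n - i) != 0 by rewrite !expf_neq0 // lt0r_neq0.
have -> : Rmult (c / N ^+ (n - i))
    (Rmult (Rdiv PI 2) (Rdiv (Rmult (wallis RF (n.-1 - i)) th)
      (pow (pow th 2) (n.-1 - i).+1))) =
   PI / 2 * (th * (c * wallis RF (n.-1 - i) / (N * th ^+ 2) ^+ (n - i))).
  rewrite !RpowE -E !RealsE (exprMn (n - i) N) -[(nat_of_pos 2)%:R]/(2%:R : RF).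
  move: (N ^+ (n - i)) ((th ^+ 2) ^+ (n - i)) nz0 nz1 => a b a0 b0.
  by field; rewrite a0 b0.
apply: half_line_ext => v.
rewrite !RpowE -E !RealsE (exprMn (n - i) N) invfM.
by rewrite mulrA.
Qed.

(** The poles are 0, -1, -3 and N = 3 c; the radii are 1 / 2, 1 / 2, 1.  The pole -1
    gives the largest bound, 96 (6 c + 3) / 2 = 288 c + 144 per factor. *)
Lemma pade_coefs (F : archiRealFieldType) (c n : nat) (N := 3 * c%:R : F) : (24 <= c)%N ->
  [/\ 24 ^+ n * form_coef n N 1 3 \is a Num.int,
      24 ^+ n * form_coef n (N + 1) (-1) 2 \is a Num.int
    & 24 ^+ n * form_coef n (N + 3) (-3) (-2) \is a Num.int] /\
  [/\ `|24 ^+ n * form_coef n N 1 3| <= (300 * c%:R) ^+ n,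
      `|24 ^+ n * form_coef n (N + 1) (-1) 2| <= (300 * c%:R) ^+ n
    & `|24 ^+ n * form_coef n (N + 3) (-3) (-2)| <= (300 * c%:R) ^+ n].
Proof.
move=> hc; have c24 : 24 <= c%:R :> F by rewrite -[24]/(24%:R) ler_nat.
have ni k : (k%:R : F) \is a Num.int by exact: rpred_nat.
split; split.
- apply: form_coef_int; rewrite /N ?oner_eq0 //; try by apply/eqP; lra.
  + by rewrite divr1 !rpredM.
  + have -> : 2 * (3 * c%:R) / 3 = 2 * c%:R :> F by field.
    by rewrite rpredM.
  + have -> : 6 / (1 * 3) = 2 :> F by field.
    by [].
- apply: form_coef_int; rewrite /N; try by apply/eqP; lra.
  + have -> : 2 * (3 * c%:R + 1) / -1 = - (2 * (3 * c%:R + 1)) :> F by field.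
    by rewrite rpredN rpredM // rpredD // ?rpredM // rpred1.
  + have -> : 2 * (3 * c%:R + 1) / 2 = 3 * c%:R + 1 :> F by field.
    by rewrite rpredD // ?rpredM // rpred1.
  + have -> : 6 / (-1 * 2) = - 3 :> F by field.
    by rewrite rpredN.
- apply: form_coef_int; rewrite /N; try by apply/eqP; lra.
  + have -> : 2 * (3 * c%:R + 3) / -3 = - (2 * (c%:R + 1)) :> F by field.
    by rewrite rpredN rpredM // rpredD // rpred1.
  + have -> : 2 * (3 * c%:R + 3) / -2 = - (3 * (c%:R + 1)) :> F by field.
    by rewrite rpredN rpredM // rpredD // rpred1.
  + have -> : 6 / (-3 * -2) = 1 :> F by field.
    by rewrite rpred1.
- apply: le_trans (@form_coef_le _ n N 1 3 (1 / 2) _ _ _) _; rewrite /N.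
  + by apply/andP; split; lra.
  + by rewrite normr1; lra.
  + by rewrite normr_nat; lra.
  + have -> : `|1 * 3| = 3 :> F by rewrite mul1r normr_nat.
    by rewrite lerXn2r ?nnegrE //; lra.
- apply: le_trans (@form_coef_le _ n (N + 1) (-1) 2 (1 / 2) _ _ _) _; rewrite /N.
  + by apply/andP; split; lra.
  + by rewrite normrN1; lra.
  + by rewrite normr_nat; lra.
  + have -> : `|-1 * 2| = 2 :> F by rewrite mulN1r normrN normr_nat.
    by rewrite lerXn2r ?nnegrE //; lra.
- apply: le_trans (@form_coef_le _ n (N + 3) (-3) (-2) 1 _ _ _) _; rewrite /N.
  + by apply/andP; split; lra.
  + by rewrite normrN normr_nat; lra.
  + by rewrite normrN normr_nat; lra.
  + have -> : `|-3 * -2| = 6 :> F by rewrite mulrNN -natrM normr_nat.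
    by rewrite lerXn2r ?nnegrE //; lra.
Qed.

(** As a function of u = N (v^2 + 1), with N = 3 c, the kernel to the power n is
    N^(2 n) (u - N)^n / (u^n (u + 1)^n (u + 3)^n); integrate its partial fractions
    term by term, N^(2 n) = (N^2 / 24)^n 24^n. *)
Lemma pade_forms_ring (c n : nat) (th1 th2 : RF) : (24 <= c)%N -> (0 < n)%N ->
  0 < th1 -> 0 < th2 -> th1 ^+ 2 = 1 + (3 * c%:R)^-1 -> th2 ^+ 2 = 1 + c%:R^-1 ->
  exists P0 P1 P2 : RF, [/\ P0 \is a Num.int, P1 \is a Num.int & P2 \is a Num.int] /\
   [/\ `|P0| <= (300 * c%:R) ^+ n, `|P1| <= (300 * c%:R) ^+ n & `|P2| <= (300 * c%:R) ^+ n] /\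
   half_line_integral
     (fun v => (v ^+ 2 / ((v ^+ 2 + 1) * (v ^+ 2 + th1 ^+ 2) * (v ^+ 2 + th2 ^+ 2))) ^+ n)
     (PI / 2 * (((3 * c%:R) ^+ 2 / 24) ^+ n * (P0 + P1 * th1 + P2 * th2))).
Proof.
move=> hc n0 h1 h2 e1 e2.
pose N : RF := 3 * c%:R.
have [[i0 i1 i2] [b0 b1 b2]] := @pade_coefs RF c n hc.
eexists; eexists; eexists; split; first by split; [exact: i0 | exact: i1 | exact: i2].
split; first by split; [exact: b0 | exact: b1 | exact: b2].
have c24 : 24 <= c%:R :> RF by rewrite -[24]/(24%:R) ler_nat.
have N0 : 0 < N by rewrite /N; lra.
have c0 : c%:R != 0 :> RF by apply/eqP; lra.
have y0E : N * 1 ^+ 2 = N by rewrite expr1n mulr1.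
have y1E : N * th1 ^+ 2 = N + 1 by rewrite e1 mulrDr mulr1 divff // lt0r_neq0.
have y2E : N * th2 ^+ 2 = N + 3 by rewrite e2 mulrDr mulr1 /N -mulrA divff // mulr1.
have H0 := @half_line_form n N 1 1 3 N0 ltr01.
have H1 := @half_line_form n N th1 (-1) 2 N0 h1.
have H2 := @half_line_form n N th2 (-3) (-2) N0 h2.
rewrite y0E in H0; rewrite y1E in H1; rewrite y2E in H2.
have H := half_line_scal _ _ (N ^+ (2 * n)) (half_line_plus _ _ _ _ (half_line_plus _ _ _ _ H0 H1) H2).
have EL : PI / 2 * ((N ^+ 2 / 24) ^+ n * (24 ^+ n * form_coef n N 1 3 +
    24 ^+ n * form_coef n (N + 1) (-1) 2 * th1 + 24 ^+ n * form_coef n (N + 3) (-3) (-2) * th2)) =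
  N ^+ (2 * n) * (PI / 2 * (1 * form_coef n N 1 3) + PI / 2 * (th1 * form_coef n (N + 1) (-1) 2) +
    PI / 2 * (th2 * form_coef n (N + 3) (-3) (-2))) :> RF.
  rewrite exprMn exprVn -exprM.
  have : (24 : RF) ^+ n != 0 by rewrite expf_neq0 // pnatr_eq0.
  move: (24 ^+ n) (N ^+ (2 * n)) (form_coef _ _ _ _) (form_coef _ _ _ _) (form_coef _ _ _ _) => a A f0 f1 f2 a0.
  by field.
rewrite EL; apply: half_line_ext H => v.
pose u : RF := N * (v ^+ 2 + 1 ^+ 2).
have v0 : 0 <= (v : RF) ^+ 2 by rewrite sqr_ge0.
have p1 : 0 < th1 ^+ 2 by rewrite exprn_gt0.
have p2 : 0 < th2 ^+ 2 by rewrite exprn_gt0.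
have u0 : u - 0 = N * (v ^+ 2 + 1 ^+ 2) by rewrite subr0.
have u1 : u - -1 = N * (v ^+ 2 + th1 ^+ 2) by rewrite mulrDr y1E /u; ring.
have u2 : u - -3 = N * (v ^+ 2 + th2 ^+ 2) by rewrite mulrDr y2E /u; ring.
have z0 : v ^+ 2 + 1 ^+ 2 != 0 :> RF by apply/eqP; rewrite expr1n; lra.
have z1 : v ^+ 2 + th1 ^+ 2 != 0 :> RF by apply/eqP; lra.
have z2 : v ^+ 2 + th2 ^+ 2 != 0 :> RF by apply/eqP; lra.
have Nz := lt0r_neq0 N0.
have ub b w : u - b = N * w -> w != 0 -> u != b by move=> e w0; rewrite -subr_eq0 e mulf_neq0.
have b01 : (0 : RF) != -1 by apply/eqP; lra.
have b02 : (0 : RF) != -3 by apply/eqP; lra.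
have b12 : (-1 : RF) != -3 by apply/eqP; lra.
have := @partial_fractions_eval RF n N 0 (-1) (-3) u n0 b01 b02 b12 (ub _ _ u0 z0) (ub _ _ u1 z1) (ub _ _ u2 z2).
rewrite u0 u1 u2.
have -> : N - 0 = N by rewrite subr0.
have -> : N - -1 = N + 1 by rewrite opprK.
have -> : N - -3 = N + 3 by rewrite opprK.
have -> : 0 - -1 = 1 :> RF by rewrite opprK add0r.
have -> : 0 - -3 = 3 :> RF by rewrite opprK add0r.
have -> : -1 - 0 = -1 :> RF by rewrite subr0.
have -> : -1 - -3 = 2 :> RF by ring.
have -> : -3 - 0 = -3 :> RF by rewrite subr0.
have -> : -3 - -1 = -2 :> RF by ring.
move=> HE; rewrite !RealsE -HE.
have -> : u - N = N * v ^+ 2 by rewrite /u expr1n; ring.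
rewrite exprM -!exprMn -!exprVn -!exprMn; congr (_ ^+ _).
rewrite expr1n in z0 *; field.
by rewrite z0 z1 z2 Nz.
Qed.

End LinearForms.

Section LinearFormsOverR.
Import Reals ZArith.
Import all_boot all_order all_algebra Rstruct.
Import Order.TTheory GRing.Theory Num.Theory.
Local Open Scope R_scope.
Local Notation RF := RbaseSymbolsImpl_R__canonical__Num_ArchiRealField.

Lemma int_IZR (x : RF) : x \is a Num.int -> exists P : Z, x = IZR P.
Proof.
move=> /intrP[m ->]; case: m => m.
  by exists (Z.of_nat m); rewrite -INR_IZR_INZ INRE.
by exists (Z.opp (Z.of_nat m.+1)); rewrite opp_IZR -INR_IZR_INZ INRE.
Qed.

Lemma pade_forms (C : Z) (n : nat) (th1 th2 : R) : Z.le 24 C -> n <> O ->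
  0 < th1 -> 0 < th2 -> th1 ^ 2 = 1 + / (3 * IZR C) -> th2 ^ 2 = 1 + / IZR C ->
  exists P0 P1 P2 : Z,
   [/\ Rabs (IZR P0) <= (300 * IZR C) ^ n, Rabs (IZR P1) <= (300 * IZR C) ^ n
     & Rabs (IZR P2) <= (300 * IZR C) ^ n] /\
   half_line_integral
     (fun v => (v ^ 2 / ((v ^ 2 + 1) * (v ^ 2 + th1 ^ 2) * (v ^ 2 + th2 ^ 2))) ^ n)
     (PI / 2 * (((3 * IZR C) ^ 2 / 24) ^ n * (IZR P0 + IZR P1 * th1 + IZR P2 * th2))).
Proof.
move=> hC /eqP; rewrite -lt0n => n0 h1 h2 e1 e2.
pose c := Z.to_nat C.
have cE : IZR C = INR c by rewrite INR_IZR_INZ Z2Nat.id //; apply: Z.le_trans hC.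
have hc : (24 <= c)%N by apply/ssrnat.leP; apply/Nat2Z.inj_le; rewrite Z2Nat.id //; apply: Z.le_trans hC.
rewrite !cE in e1 e2 *.
have [||||P0 [P1 [P2 [[/int_IZR [p0 ->] /int_IZR [p1 ->] /int_IZR [p2 ->]] [[b0 b1 b2] H]]]]] :=
  @pade_forms_ring c n th1 th2 hc n0.
- exact/RltP.
- exact/RltP.
- by rewrite -RpowE e1 !RealsE.
- by rewrite -RpowE e2 !RealsE.
exists p0, p1, p2; split.
  by split; apply/RleP; rewrite !RealsE.
have -> : PI / 2 * (((3 * INR c) ^ 2 / 24) ^ n * (IZR p0 + IZR p1 * th1 + IZR p2 * th2)) =
  (PI / 2 * (((3 * c%:R) ^+ 2 / 24) ^+ n * (IZR p0 + IZR p1 * th1 + IZR p2 * th2)) : RF)%R.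
  by rewrite !RealsE.
by apply: half_line_ext H => v; rewrite !RealsE.
Qed.

End LinearFormsOverR.


(** * An upper bound for z *)
Section Approximation.
Import Reals Lra Lia ZArith Coquelicot.Coquelicot.
Import ssreflect ssrfun ssrbool.
Local Open Scope R_scope.

Section Kernel.
Variables (a b : R).
Hypotheses (ha : 1 <= a <= 1 + 1 / 20000) (hb : 1 <= b <= 1 + 1 / 20000).

Let g (v : R) := v ^ 2 / ((v ^ 2 + 1) * (v ^ 2 + a) * (v ^ 2 + b)).

Let g_den v : (v ^ 2 + 1) ^ 3 <= (v ^ 2 + 1) * (v ^ 2 + a) * (v ^ 2 + b) <= (v ^ 2 + 1 + 1 / 20000) ^ 3.
Proof.
have := pow2_ge_0 v; move: (v ^ 2) => X X0.
have h1 : (X + 1) * (X + 1) <= (X + a) * (X + b) by nra.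
have h2 : (X + a) * (X + b) <= (X + 1 + 1 / 20000) * (X + 1 + 1 / 20000) by nra.
by split; nra.
Qed.

Let g_pos v : 0 <= g v.
Proof.
have [h _] := g_den v; have h0 := pow2_ge_0 v.
have : 0 < (v ^ 2 + 1) ^ 3 by apply: pow_lt; lra.
by move=> h1; apply: Rdiv_le_0_compat; lra.
Qed.

(* X / (X + 1)^3 is greatest at X = 1 / 2, and X / (X + 1)^2 at X = 1. *)
Let g_le v : g v <= 4 / 27 /\ g v <= 1 / 4 * / (v ^ 2 + 1 ^ 2) ^ 1.
Proof.
have [h _] := g_den v; have := pow2_ge_0 v.
rewrite /g; move: h; move: (_ * (v ^ 2 + b)) => D; move: (v ^ 2) => X h X0.
have D0 : 0 < (X + 1) ^ 3 by apply: pow_lt; lra.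
have hD : / D <= / (X + 1) ^ 3 by apply: Rinv_le_contravar.
have h1 : X / D <= X / (X + 1) ^ 3 by apply: Rmult_le_compat_l.
split; apply: Rle_trans h1 _.
- apply/Rle_div_l => //.
  have -> : 4 / 27 * (X + 1) ^ 3 = X + (2 * X - 1) ^ 2 * (X + 4) / 27 by field.
  by have := pow2_ge_0 (2 * X - 1); nra.
- apply/Rle_div_l => //.
  have -> : 1 / 4 * / (X + 1 ^ 2) ^ 1 * (X + 1) ^ 3 = X + (X - 1) ^ 2 / 4 by field; lra.
  by have := pow2_ge_0 (X - 1); lra.
Qed.

(* The interval surrounds the maximum of the kernel, near v = 1 / sqrt 2. *)
Let g_ge v : 3 / 5 <= v <= 4 / 5 -> 14 / 100 <= g v.
Proof.
move=> hv; have [h1 h2] := g_den v; have h0 := pow2_ge_0 v.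
have hX : 36 / 100 <= v ^ 2 <= 64 / 100 by split; nra.
have D0 : 0 < (v ^ 2 + 1) ^ 3 by apply: pow_lt; lra.
have D0' : 0 < (v ^ 2 + 1) * (v ^ 2 + a) * (v ^ 2 + b) by lra.
apply: (proj1 (Rle_div_r (14 / 100) (v ^ 2) _ D0')).
apply: (Rle_trans _ (14 / 100 * (v ^ 2 + 1 + 1 / 20000) ^ 3)).
  by apply: Rmult_le_compat_l; lra.
move: (v ^ 2) hX => X hX; rewrite /=; nra.
Qed.

Let g_cont n v : continuous (fun v => g v ^ n) v.
Proof.
apply: ex_derive_continuous; rewrite /g; auto_derive.
have [h1 h2] := g_den v; have h0 := pow2_ge_0 v.
have D0 : 0 < (v ^ 2 + 1) ^ 3 by apply: pow_lt; lra.
by cbn [pow] in *; lra.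
Qed.

Let g_int n u v : ex_RInt (fun v => g v ^ n) u v.
Proof. by apply: ex_RInt_continuous => w _; apply: g_cont. Qed.

Lemma kernel_integral_le n l : half_line_integral (fun v => g v ^ S n) l ->
  l <= PI / 8 * (4 / 27) ^ n.
Proof.
move=> H.
have H2 := half_line_scal _ _ (1 / 4 * (4 / 27) ^ n) (half_line_wallis 1 0 Rlt_0_1).
have E : 1 / 4 * (4 / 27) ^ n * (PI / 2 * (wallisR 0 * 1 / (1 ^ 2) ^ 1)) = PI / 8 * (4 / 27) ^ n.
  by rewrite /=; field.
rewrite E in H2; case: H => [eH lH]; case: H2 => [eH2 lH2].
apply: (is_lim_le_loc _ _ p_infty l (PI / 8 * (4 / 27) ^ n) _ lH lH2).
apply: (near_infinity _ 0) => A A0.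
apply: RInt_le; [lra | by apply: eH; lra | by apply: eH2; lra |].
move=> v _; have [h1 h2] := g_le v; have h0 := g_pos v.
have h3 : g v ^ n <= (4 / 27) ^ n by apply: pow_incr.
have h4 : 0 <= g v ^ n by apply: pow_le.
cbn [pow]; cbn [pow] in h2.
have -> : 1 / 4 * (4 / 27) ^ n * / ((v * (v * 1) + 1 * (1 * 1)) * 1) =
  (1 / 4 * / ((v * (v * 1) + 1 * (1 * 1)) * 1)) * (4 / 27) ^ n by ring.
by apply: Rmult_le_compat.
Qed.

Lemma kernel_integral_ge n l : half_line_integral (fun v => g v ^ n) l ->
  1 / 5 * (14 / 100) ^ n <= l.
Proof.
move=> H; apply: (half_line_ge _ _ _ (4 / 5) H) => A hA.
have pos u w : u <= w -> 0 <= RInt (fun v => g v ^ n) u w.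
  by move=> uw; apply: RInt_ge_0 => // v _; apply: pow_le.
have e1 := RInt_Chasles (fun v => g v ^ n) 0 (3 / 5) A (g_int _ _ _) (g_int _ _ _).
have e2 := RInt_Chasles (fun v => g v ^ n) (3 / 5) (4 / 5) A (g_int _ _ _) (g_int _ _ _).
have e3 : 1 / 5 * (14 / 100) ^ n <= RInt (fun v => g v ^ n) (3 / 5) (4 / 5).
  have -> : 1 / 5 * (14 / 100) ^ n = RInt (fun _ => (14 / 100) ^ n) (3 / 5) (4 / 5).
    by rewrite RInt_const /scal /= /mult /=; field.
  apply: RInt_le; [lra | exact: ex_RInt_const | exact: g_int |].
  by move=> v hv; apply: pow_incr; split; [lra | apply: g_ge; lra].
have p1 := pos 0 (3 / 5) (ltac:(lra)); have p2 := pos (4 / 5) A hA.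
move: e1 e2; rewrite /plus /= => e1 e2; lra.
Qed.

End Kernel.

Lemma bracket_power G w : 1 < G -> 1 < w -> exists n, G ^ n < w <= G ^ S n.
Proof.
move=> G1 w1.
have [m hm] : exists m, w <= G ^ m.
  have [N hN] := Pow_x_infinity G (ltac:(rewrite Rabs_pos_eq; lra)) w.
  exists N; have := hN N (Nat.le_refl N); rewrite Rabs_pos_eq; first lra.
  by apply: pow_le; lra.
elim: m hm => [|m IH] hm; first by rewrite /= in hm; lra.
by case: (Rle_lt_dec w (G ^ m)) => h; [apply: IH | exists m].
Qed.

(** Meant for w = t y, k = 3, th = theta1 and for w = s x, k = 1, th = theta2.  The
    difference is the quotient of w^2 - (k z th)^2 = k th^2 (c - k) by
    w + k z th. *)
Lemma approximation_error (c k w z th : R) : 3 <= c -> 0 < z -> 0 < w -> 0 < th <= 2 ->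
  1 <= k <= 3 -> w ^ 2 = k ^ 2 * z ^ 2 * th ^ 2 + k * th ^ 2 * (c - k) ->
  0 <= w - k * z * th <= 2 * c / z.
Proof.
move=> hc z0 w0 hth hk hw.
set d := w - k * z * th.
have kz0 : 0 < k * z * th by repeat apply: Rmult_lt_0_compat; lra.
have hd : d * (w + k * z * th) = k * th ^ 2 * (c - k).
  have -> : d * (w + k * z * th) = w ^ 2 - k ^ 2 * z ^ 2 * th ^ 2 by rewrite /d; ring.
  by rewrite hw; ring.
have th2 : 0 < th ^ 2 by apply: pow_lt; lra.
have r0 : 0 <= k * th ^ 2 * (c - k) by repeat apply: Rmult_le_pos; lra.
have d0 : 0 <= d.
  case: (Rle_lt_dec 0 d) => // dneg.
  have : d * (w + k * z * th) < 0 by nra.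
  by lra.
split => //.
apply: (proj1 (Rle_div_r _ _ _ z0)).
have h1 : d * (k * z * th) <= d * (w + k * z * th) by apply: Rmult_le_compat_l; lra.
have h2 : k * th ^ 2 * (c - k) <= k * th ^ 2 * c.
  by apply: Rmult_le_compat_l; [apply: Rmult_le_pos; lra | lra].
have h3 : (k * th) * (d * z) <= (k * th) * (th * c).
  have -> : (k * th) * (d * z) = d * (k * z * th) by ring.
  have -> : (k * th) * (th * c) = k * th ^ 2 * c by ring.
  by lra.
have h4 : d * z <= th * c by apply: Rmult_le_reg_l h3; apply: Rmult_lt_0_compat; lra.
by nra.
Qed.

(** K is the linear form multiplied by (9 c^2 / 24)^n. *)
Lemma form_size (n : nat) (K : R) :
  1 / 5 * (14 / 100) ^ n <= PI / 2 * K -> PI / 2 * K <= PI / 8 * (4 / 27) ^ Nat.pred n -> n <> O ->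
  1 / 10 * (14 / 100) ^ n <= K <= 27 / 16 * (4 / 27) ^ n.
Proof.
move=> h1 h2; case: n h1 h2 => [|n] // h1 h2 _.
have p0 := PI_RGT_0; have p4 := PI_4.
split.
- have : 0 < (14 / 100) ^ S n by apply: pow_lt; lra.
  by nra.
- rewrite /= in h2; have -> : 27 / 16 * (4 / 27) ^ S n = 1 / 4 * (4 / 27) ^ n by rewrite /=; field.
  by apply: (Rmult_le_reg_l (PI / 2)); lra.
Qed.

(** The two sides are of the orders of c^(n + 5) and c^(2 n); because of the
    constants, the inequality still fails for n = 11 and c = 23408. *)
Lemma numeric_comparison c n : 23408 <= c -> Peano.le 13 n ->
  6000 * c * (81 / 32 * c ^ 2) ^ 2 * (300 * c) ^ n < (945 / 1000) ^ n * (81 / 32 * c ^ 2) ^ n.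
Proof.
move=> hc hn.
have c0 : 0 < c by lra.
rewrite -Rpow_mult_distr.
have -> : 945 / 1000 * (81 / 32 * c ^ 2) = (300 * c) * (945 * 81 / (32000 * 300) * c) by field.
rewrite (Rpow_mult_distr (300 * c)) Rmult_comm.
apply: Rmult_lt_compat_l; first by apply: pow_lt; lra.
have h1 : 1 <= 945 * 81 / (32000 * 300) * c by lra.
apply: (Rlt_le_trans _ ((945 * 81 / (32000 * 300) * c) ^ 13)); last by apply: Rle_pow.
have -> : (945 * 81 / (32000 * 300) * c) ^ 13 =
  (945 * 81 / (32000 * 300)) ^ 5 * c ^ 5 * (945 * 81 / (32000 * 300) * c) ^ 8 by ring.
have h2 : 180 ^ 8 <= (945 * 81 / (32000 * 300) * c) ^ 8 by apply: pow_incr; lra.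
have -> : 6000 * c * (81 / 32 * c ^ 2) ^ 2 = 6000 * (81 / 32) ^ 2 * c ^ 5 by ring.
have c5 : 0 < c ^ 5 by apply: pow_lt.
apply: (Rlt_le_trans _ ((945 * 81 / (32000 * 300)) ^ 5 * c ^ 5 * 180 ^ 8)).
  have -> : (945 * 81 / (32000 * 300)) ^ 5 * c ^ 5 * 180 ^ 8 =
    ((945 * 81 / (32000 * 300)) ^ 5 * 180 ^ 8) * c ^ 5 by ring.
  by apply: Rmult_lt_compat_r => //; lra.
apply: Rmult_le_compat_l => //.
by apply: Rmult_le_pos; [apply: pow_le; lra | lra].
Qed.

Lemma no_integer_between (T : Z) : 0 < IZR T < 1 -> False.
Proof. by move=> [/lt_IZR h1 /lt_IZR h2]; lia. Qed.

(** G = 81 c^2 / 32 is the reciprocal of (4 / 27) * 8 / (3 c^2), so that the linear form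
    of order n is at most 27 / 16 * G^-n, and at least 0.945^n G^-n / 10.  The least
    n with G^n >= 81 / 8 * z makes 3 z times the form at most 1 / 2 while keeping it
    above the error, because G^n exceeds 81 / 8 * z by a factor at most G.  The
    hypothesis on z is what forces n >= 13, as G < 3 c^2. *)
Lemma order_choice c z : 23408 <= c -> (3 * c * c) ^ 12 < z ->
  exists n, [/\ Peano.le 13 n, 81 / 8 * z <= (81 / 32 * c ^ 2) ^ n &
    6000 * c * (300 * c) ^ n < z * z * ((945 / 1000) ^ n * / (81 / 32 * c ^ 2) ^ n) * 120].
Proof.
move=> hc hz.
set G := 81 / 32 * c ^ 2.
have cc : 23408 * 23408 <= c ^ 2 by nra.
have G1 : 1 < G by rewrite /G; lra.
have c12 : G ^ 12 <= (3 * c * c) ^ 12.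
  by apply: pow_incr; rewrite /G; split; nra.
have G12 : 1 <= G ^ 12 by apply: pow_R1_Rle; lra.
have [m [hm1 hm2]] := bracket_power G (81 / 8 * z) G1 (ltac:(lra)).
have m12 : Peano.le 12 m.
  case: (Compare_dec.le_lt_dec 12 m) => // h.
  have : G ^ S m <= G ^ 12 by apply: Rle_pow; [lra | lia].
  by lra.
have n13 : Peano.le 13 (S m) by lia.
exists (S m); split => //.
have := numeric_comparison c (S m) hc n13; rewrite -/G => hn.
have Gm : 0 < G ^ m by apply: pow_lt; lra.
have GS : G ^ S m = G * G ^ m by [].
have Gn : 0 < G ^ S m by apply: pow_lt; lra.
set e := (945 / 1000) ^ S m in hn *; set Q := (300 * c) ^ S m in hn *.
have e0 : 0 < e by apply: pow_lt; lra.
have hz2 : G ^ m * G ^ m <= (81 / 8 * z) * (81 / 8 * z) by apply: Rmult_le_compat; lra.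
have h1 : G ^ S m * G ^ S m <= z * z * (G ^ 2 * 104).
  rewrite GS; have -> : G * G ^ m * (G * G ^ m) = G ^ 2 * (G ^ m * G ^ m) by ring.
  have G2 : 0 < G ^ 2 by apply: pow_lt; lra.
  have := Rmult_le_compat_l _ _ _ (Rlt_le _ _ G2) hz2; nra.
have G2 : 0 < G ^ 2 by apply: pow_lt; lra.
apply: (Rmult_lt_reg_r (G ^ 2)) => //.
have -> : 6000 * c * Q * G ^ 2 = 6000 * c * G ^ 2 * Q by ring.
apply: (Rlt_le_trans _ _ _ hn).
have -> : e * G ^ S m = (G ^ S m * G ^ S m) * (e * / G ^ S m) by field; lra.
have -> : z * z * (e * / G ^ S m) * 120 * G ^ 2 = (z * z * (G ^ 2 * 120)) * (e * / G ^ S m) by ring.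
apply: Rmult_le_compat_r.
  by apply: Rmult_le_pos; [lra | apply: Rlt_le; apply: Rinv_0_lt_compat].
by have := Rle_0_sqr z; rewrite /Rsqr; nra.
Qed.

(** Multiply the linear form by 3 z and replace 3 z theta1 by t y and z theta2 by s x: the
    result is an integer, in which the form contributes a positive number at
    most 1 / 2, larger than the total error 8 c (300 c)^n / z. *)
Lemma pade_bound (C s t x y z : Z) : (23408 <= C)%Z ->
  (0 < s)%Z -> (0 < t)%Z -> (0 < x)%Z -> (0 < y)%Z -> (0 < z)%Z ->
  (s * s = C + 1)%Z -> (t * t = 3 * C + 1)%Z ->
  (C * (x * x) = z * z + C - 1)%Z -> (C * (y * y) = 3 * (z * z) + C - 3)%Z ->
  (z <= (3 * C * C) ^ 12)%Z.
Proof.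
move=> hC s0 t0 x0 y0 z0 hs ht hx hy.
case: (Z_le_gt_dec z ((3 * C * C) ^ 12)) => // hz; exfalso.
pose c := IZR C; pose Z' := IZR z.
have hc : 23408 <= c by apply: IZR_le.
have hzR : (3 * c * c) ^ 12 < Z'.
  rewrite /c /Z' -!mult_IZR pow_IZR; apply: IZR_lt; change (Z.of_nat 12) with 12%Z; lia.
have Z0 : 0 < Z' by apply: IZR_lt.
have pos w : (0 < w)%Z -> 0 < IZR w by move=> h; apply: IZR_lt.
have hs' : IZR s * IZR s = c + 1 by rewrite /c -mult_IZR hs plus_IZR.
have ht' : IZR t * IZR t = 3 * c + 1 by rewrite /c -mult_IZR ht plus_IZR mult_IZR.
have hx' : c * (IZR x * IZR x) = Z' * Z' + c - 1.
  by rewrite /c /Z' -!mult_IZR hx minus_IZR plus_IZR.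
have hy' : c * (IZR y * IZR y) = 3 * (Z' * Z') + c - 3.
  by rewrite /c /Z' -!mult_IZR hy minus_IZR plus_IZR mult_IZR.
pose th1 := IZR t / sqrt (3 * c); pose th2 := IZR s / sqrt c.
have q1 : 0 < sqrt (3 * c) by apply: sqrt_lt_R0; lra.
have q2 : 0 < sqrt c by apply: sqrt_lt_R0; lra.
have th10 : 0 < th1 by apply: Rdiv_lt_0_compat => //; apply: pos.
have th20 : 0 < th2 by apply: Rdiv_lt_0_compat => //; apply: pos.
have e1 : th1 ^ 2 = 1 + / (3 * c).
  have -> : th1 ^ 2 = (IZR t * IZR t) / (sqrt (3 * c) * sqrt (3 * c)) by rewrite /th1; field; lra.
  by rewrite sqrt_sqrt ?ht'; [field; lra | lra].
have e2 : th2 ^ 2 = 1 + / c.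
  have -> : th2 ^ 2 = (IZR s * IZR s) / (sqrt c * sqrt c) by rewrite /th2; field; lra.
  by rewrite sqrt_sqrt ?hs'; [field; lra | lra].
have i1 : 0 < / (3 * c) <= 1 / 20000.
  split; first by apply: Rinv_0_lt_compat; lra.
  by rewrite /Rdiv Rmult_1_l; apply: Rinv_le_contravar; lra.
have i2 : 0 < / c <= 1 / 20000.
  split; first by apply: Rinv_0_lt_compat; lra.
  by rewrite /Rdiv Rmult_1_l; apply: Rinv_le_contravar; lra.
have th12 : th1 <= 2 by nra.
have th22 : th2 <= 2 by nra.
have [n [n13 hn1 hn2]] := order_choice c Z' hc hzR.
have n0 : n <> O by lia.
have [P0 [P1 [P2 [[b0 b1 b2] H]]]] :=
  pade_forms C n th1 th2 (ltac:(lia)) n0 th10 th20 e1 e2.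
rewrite -/c in b0 b1 b2 H.
set L := IZR P0 + IZR P1 * th1 + IZR P2 * th2 in H.
set K := ((3 * c) ^ 2 / 24) ^ n * L in H.
have hK : 1 / 10 * (14 / 100) ^ n <= K <= 27 / 16 * (4 / 27) ^ n.
  apply: form_size => //.
  - by apply: (kernel_integral_ge (th1 ^ 2) (th2 ^ 2)) H; rewrite ?e1 ?e2; lra.
  - have En : n = S (Nat.pred n) by lia.
    apply: (kernel_integral_le (th1 ^ 2) (th2 ^ 2)); rewrite ?e1 ?e2 -?En -?e1 -?e2 //; lra.
have w1 : (IZR t * IZR y) ^ 2 = 3 ^ 2 * Z' ^ 2 * th1 ^ 2 + 3 * th1 ^ 2 * (c - 3).
  have -> : 3 ^ 2 * Z' ^ 2 * th1 ^ 2 + 3 * th1 ^ 2 * (c - 3) =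
    3 * th1 ^ 2 * (3 * (Z' * Z') + c - 3) by ring.
  rewrite e1 -hy'; have -> : (IZR t * IZR y) ^ 2 = (IZR t * IZR t) * (IZR y * IZR y) by ring.
  by rewrite ht'; field; lra.
have w2 : (IZR s * IZR x) ^ 2 = 1 ^ 2 * Z' ^ 2 * th2 ^ 2 + 1 * th2 ^ 2 * (c - 1).
  have -> : 1 ^ 2 * Z' ^ 2 * th2 ^ 2 + 1 * th2 ^ 2 * (c - 1) =
    th2 ^ 2 * (Z' * Z' + c - 1) by ring.
  rewrite e2 -hx'; have -> : (IZR s * IZR x) ^ 2 = (IZR s * IZR s) * (IZR x * IZR x) by ring.
  by rewrite hs'; field; lra.
have ty0 := Rmult_lt_0_compat _ _ (pos _ t0) (pos _ y0).
have sx0 := Rmult_lt_0_compat _ _ (pos _ s0) (pos _ x0).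
have c3 : 3 <= c by lra.
have k3 : 1 <= 3 <= 3 by lra.
have k1 : 1 <= 1 <= 3 by lra.
have [d1 d1'] := approximation_error c 3 _ Z' th1 c3 Z0 ty0 (conj th10 th12) k3 w1.
have [d2 d2'] := approximation_error c 1 _ Z' th2 c3 Z0 sx0 (conj th20 th22) k1 w2.
set D1 := IZR t * IZR y - 3 * Z' * th1 in d1 d1'.
set D2 := IZR s * IZR x - 1 * Z' * th2 in d2 d2'.
apply: (no_integer_between (3 * z * P0 + t * y * P1 + 3 * s * x * P2)).
have -> : IZR (3 * z * P0 + t * y * P1 + 3 * s * x * P2) = 3 * Z' * L + (IZR P1 * D1 + 3 * IZR P2 * D2).
  by rewrite !plus_IZR !mult_IZR /L /D1 /D2 /Z'; ring.
set G := 81 / 32 * c ^ 2 in hn1 hn2.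
have G0 : 0 < G by rewrite /G; have := pow_lt c 2 (ltac:(lra)); lra.
have Gn : 0 < G ^ n by apply: pow_lt.
have LK : L = K * (8 / (3 * c ^ 2)) ^ n.
  rewrite /K; have -> : ((3 * c) ^ 2 / 24) ^ n * L * (8 / (3 * c ^ 2)) ^ n =
    L * (((3 * c) ^ 2 / 24) * (8 / (3 * c ^ 2))) ^ n by rewrite (Rpow_mult_distr ((3 * c) ^ 2 / 24)); ring.
  have -> : ((3 * c) ^ 2 / 24) * (8 / (3 * c ^ 2)) = 1 by field; lra.
  by rewrite pow1; ring.
set un := (8 / (3 * c ^ 2)) ^ n in LK.
have un0 : 0 < un by apply: pow_lt; apply: Rdiv_lt_0_compat; [lra | have := pow_lt c 2 (ltac:(lra)); lra].
have c20 : 0 < c ^ 2 by apply: pow_lt; lra.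
have uG : (4 / 27) ^ n * un = / G ^ n.
  rewrite /un -Rpow_mult_distr -pow_inv; congr (_ ^ _); rewrite /G; field; lra.
have uG2 : (14 / 100) ^ n * un = (945 / 1000) ^ n * / G ^ n.
  rewrite /un -pow_inv -!Rpow_mult_distr; congr (_ ^ _); rewrite /G; field; lra.
have L1 : L <= 27 / 16 * / G ^ n.
  rewrite LK -uG; have -> : 27 / 16 * ((4 / 27) ^ n * un) = (27 / 16 * (4 / 27) ^ n) * un by ring.
  by apply: Rmult_le_compat_r; lra.
set en := (945 / 1000) ^ n * / G ^ n in uG2 hn2.
have L2 : 1 / 10 * en <= L.
  rewrite LK -uG2; have -> : 1 / 10 * ((14 / 100) ^ n * un) = (1 / 10 * (14 / 100) ^ n) * un by ring.
  by apply: Rmult_le_compat_r; lra.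
set Q := (300 * c) ^ n in b0 b1 b2 hn2.
have Q0 : 0 < Q by apply: pow_lt; lra.
have err : Rabs (IZR P1 * D1 + 3 * IZR P2 * D2) <= 8 * c * Q / Z'.
  apply: Rle_trans (Rabs_triang _ _) _.
  rewrite !Rabs_mult (Rabs_pos_eq D1) // (Rabs_pos_eq D2) // (Rabs_pos_eq 3); last lra.
  have h1 : Rabs (IZR P1) * D1 <= Q * (2 * c / Z') by apply: Rmult_le_compat => //; exact: Rabs_pos.
  have h2 : Rabs (IZR P2) * D2 <= Q * (2 * c / Z') by apply: Rmult_le_compat => //; exact: Rabs_pos.
  have -> : 8 * c * Q / Z' = Q * (2 * c / Z') + 3 * (Q * (2 * c / Z')) by field; lra.
  by lra.
have main : 3 * Z' * L <= 1 / 2.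
  have h : 3 * Z' * L <= 3 * Z' * (27 / 16 * / G ^ n) by apply: Rmult_le_compat_l; lra.
  apply: Rle_trans h _.
  have -> : 3 * Z' * (27 / 16 * / G ^ n) = (81 / 16 * Z') / G ^ n by field; lra.
  by apply: (proj2 (Rle_div_l _ _ _ Gn)); lra.
have small : 8 * c * Q / Z' < 3 * Z' * L.
  apply: (Rlt_le_trans _ (3 * Z' * (1 / 10 * en))); last by apply: Rmult_le_compat_l; lra.
  have cQ : 0 < c * Q by apply: Rmult_lt_0_compat; lra.
  have h : 8 * c * Q < 3 * Z' * (1 / 10 * en) * Z' by lra.
  exact: (proj2 (Rlt_div_l (8 * c * Q) (3 * Z' * (1 / 10 * en)) Z' Z0) h).
have := Rabs_def2 _ _ (Rle_lt_trans _ _ _ err small); lra.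
Qed.

End Approximation.


(** * Integer quintuples *)
Section NoQuintuple.
Import ZArith Lia List ssreflect ssrfun ssrbool.
Local Open Scope Z_scope.

(** Here s^2 = C + 1, so that 3 s^2 - 2 = 3 C + 1, and s <= 152 means C < 23408. *)
Lemma small_triples : List.forallb (fun s =>
   ~~ (Z.sqrt (3 * (s * s) - 2) * Z.sqrt (3 * (s * s) - 2) =? 3 * (s * s) - 2) ||
   List.existsb (Z.eqb s) (3 :: 11 :: 41 :: nil)%list)
  (List.map Z.of_nat (List.seq 2 151)).
Proof. by vm_compute. Qed.

Lemma small_triple C : 0 < C < 23408 -> Zsquare (1 * C + 1) -> Zsquare (3 * C + 1) ->
  C = 8 \/ C = 120 \/ C = 1680.
Proof.
move=> hC hs ht.
have [|s [s0 {}hs]] := Zsquare_pos _ hs; first by lia.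
have [|t [t0 {}ht]] := Zsquare_pos _ ht; first by lia.
have sb : 2 <= s <= 152 by clear - hs s0 hC; nia.
have sin : List.In s (List.map Z.of_nat (List.seq 2 151)).
  by apply/List.in_map_iff; exists (Z.to_nat s); rewrite List.in_seq; lia.
have := proj1 (List.forallb_forall _ _) small_triples s sin.
have E : 3 * (s * s) - 2 = t * t by lia.
rewrite E Z.sqrt_square ?Z.eqb_refl /=; last by lia.
by move/or3P => -[/Z.eqb_eq h|/Z.eqb_eq h|/orP[/Z.eqb_eq h|//]]; subst s; lia.
Qed.

(** For C >= 23408, [z_large] and [pade_bound] contradict each other.  Below, A and C
    are among 8, 120, 1680, and {8, 1680} fails as 115^2 < 8 * 1680 + 1 < 116^2. *)
Lemma no_quintuple_min A C e :
  (forall A' C' e', quintuple A' C' e' -> e <= e') -> quintuple A C e -> False.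
Proof.
move=> hmin hq.
have [d [z [hd z0 hz base]]] := quintuple_base A C e hmin hq.
have [hAC hCe [hA1 hC1 he1] [hA3 hC3 he3] [hAC1 hAe hCe1]] := hq.
have z1 : 1 < z by clear - z0 hz hAC hCe; nia.
have m0 D r m (b : Z) : z = d * pellA D r m + b * pellB D r m -> m <> O.
  by move=> zm E; move: zm; rewrite E; cbn [pell fst snd]; lia.
have [r1 [m1 [r10 hr1 zm1 e1]]] := base 1 (or_introl erefl).
have [r3 [m3 [r30 hr3 zm3 e3]]] := base 3 (or_intror (or_introl erefl)).
have [rA [mA [rA0 hrA zmA eA]]] := base A (or_intror (or_intror erefl)).
case: (Z_lt_ge_dec C 23408) => hC.
- have C3 : C = 8 \/ C = 120 \/ C = 1680 by apply: small_triple => //; lia.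
  have A3 : A = 8 \/ A = 120 \/ A = 1680 by apply: small_triple => //; lia.
  have : (A = 8 /\ C = 120) \/ (A = 120 /\ C = 1680) \/ (A = 8 /\ C = 1680) by lia.
  case=> [[? ?]|[[? ?]|[? ?]]]; subst A C.
  + have r19 : r3 = 19 by clear - r30 hr3; nia.
    rewrite r19 in zm3.
    exact: (no_extension_8_120 e z d m3 (m0 _ _ _ _ zm3) (hz) hAe zm3).
  + have r449 : rA = 449 by clear - rA0 hrA; nia.
    rewrite r449 in zmA eA.
    exact: (no_extension_120_1680 e z d mA (m0 _ _ _ _ zmA) hd hz he1 he3 zmA eA).
  + by apply: (between_squares 115) hAC1; lia.
- rewrite Z.mul_1_l in hr1 zm1.
  have hC' : 23408 <= C by lia.
  have n25 := index_large C r1 r3 hC' r10 r30 hr1 hr3 d z m1 m3 hd z1 zm1 zm3.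
  have zl := z_large C r1 r3 hC' r10 r30 hr1 hr3 d z m3 hd zm3 n25.
  have [|x [x0 hx]] := Zsquare_pos _ he1; first by lia.
  have [|y [y0 hy]] := Zsquare_pos _ he3; first by lia.
  have := pade_bound C r1 r3 x y z hC' r10 r30 x0 y0 z0 hr1 hr3.
  by rewrite -hx -hy -hz; lia.
Qed.

Lemma no_quintuple A C e : ~ quintuple A C e.
Proof.
have [n hn] : exists n : nat, e < Z.of_nat n by exists (Z.to_nat (e + 1)); lia.
elim: n A C e hn => [|n IH] A C e hn hq; first by case: hq; lia.
apply: (no_quintuple_min A C e) => // A' C' e' hq'.
case: (Z_le_gt_dec e e') => // h.
by case: (IH A' C' e') => //; lia.
Qed.

End NoQuintuple.


(** * Reduction to integers *)
Section RationalReduction.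
Import ZArith Lia ssreflect ssrfun ssrbool.
Local Open Scope Z_scope.

Lemma divide3_square x c : x * x = 3 * c -> exists k, x = 3 * k.
Proof.
move=> h; have E := Z.div_mod x 3 (ltac:(lia)); have := Z.mod_pos_bound x 3 (ltac:(lia)).
move: E; set q := x / 3; set r := x mod 3 => E hr.
have [e|[e|e]] : r = 0 \/ r = 1 \/ r = 2 by lia.
- by exists q; lia.
- by exfalso; rewrite E e in h; lia.
- by exfalso; rewrite E e in h; lia.
Qed.

Lemma sqrt3_irrational x y : y * y = 3 * (x * x) -> x = 0 /\ y = 0.
Proof.
have [n hn] : exists n : nat, Z.abs y <= Z.of_nat n by exists (Z.to_nat (Z.abs y)); lia.
elim: n x y hn => [|n IH] x y hn h.
  have y0 : y = 0 by lia.
  by subst y; split => //; nia.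
have [k hk] := divide3_square y (x * x) h.
have h' : x * x = 3 * (k * k) by rewrite hk in h; lia.
have [j hj] := divide3_square x (k * k) h'.
have [y0|y0] := Z.eq_dec y 0; first by (subst y; split => //; nia).
have h'' : k * k = 3 * (j * j) by rewrite hj in h'; lia.
by have [] := IH j k (ltac:(lia)) h''; lia.
Qed.

Definition positive_kind a := Zsquare (1 * a + 1) /\ Zsquare (3 * a + 1).
Definition negative_kind a := exists x y, a + 1 = - (2 * (x * x)) /\ 3 * a + 1 = - (2 * (y * y)).

(** Let X = x1 + x2 sqrt(-2) and Y = y1 + y2 sqrt(-2), so that Y^2 - 3 X^2 = -2.  With
    u = y1^2 - 3 x1^2 and v = y2^2 - 3 x2^2, the rational part is u = 2 v - 2, and
    Brahmagupta's identity with y1 y2 = 3 x1 x2 gives u v = -3 q^2 <= 0.  Hence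
    v (v - 1) <= 0, so u or v vanishes, and sqrt 3 is irrational. *)
Lemma extension_kind a1 a2 x1 x2 y1 y2 :
  a1 + 1 = x1 * x1 - 2 * (x2 * x2) -> a2 = 2 * (x1 * x2) ->
  3 * a1 + 1 = y1 * y1 - 2 * (y2 * y2) -> 3 * a2 = 2 * (y1 * y2) ->
  a2 = 0 /\ (positive_kind a1 \/ negative_kind a1).
Proof.
move=> h1 h2 h3 h4.
set u := y1 * y1 - 3 * (x1 * x1); set v := y2 * y2 - 3 * (x2 * x2).
have uv : u = 2 * v - 2 by rewrite /u /v; lia.
have key : u * v = - 3 * ((x1 * y2 - x2 * y1) * (x1 * y2 - x2 * y1)).
  have -> : u * v = (y1 * y2 - 3 * (x1 * x2)) * (y1 * y2 - 3 * (x1 * x2)) -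
     3 * ((x1 * y2 - x2 * y1) * (x1 * y2 - x2 * y1)) by rewrite /u /v; ring.
  have -> : y1 * y2 - 3 * (x1 * x2) = 0 by lia.
  ring.
have : v = 0 \/ v = 1.
  have := Z.square_nonneg (x1 * y2 - x2 * y1).
  move: key; rewrite uv; move: ((x1 * y2 - x2 * y1) * (x1 * y2 - x2 * y1)) => q; clear.
  by nia.
case=> hv.
- have [E1 E2] := sqrt3_irrational x2 y2 (ltac:(move: hv; rewrite /v; clear; lia)).
  subst x2 y2; split; first by lia.
  by left; split; [exists x1 | exists y1]; lia.
- have [E1 E2] := sqrt3_irrational x1 y1 (ltac:(move: hv uv; rewrite /v /u; clear; lia)).
  subst x1 y1; split; first by lia.
  by right; exists x2, y2; lia.
Qed.

(** The integer n is the square of w1 + w2 sqrt(-2). *)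
Definition rational_square n := exists w1 w2, n = w1 * w1 - 2 * (w2 * w2) /\ w1 * w2 = 0.

Lemma rational_squareE n : rational_square n -> exists w, n = w * w \/ n = - (2 * (w * w)).
Proof.
move=> [w1 [w2 [h]]]; case/Z.mul_eq_0 => E; subst.
- by exists w2; right; lia.
- by exists w1; left; lia.
Qed.

Lemma positive_kind_mod8 a : positive_kind a -> a <> 0 -> 0 < a /\ exists k, a = 8 * k.
Proof.
move=> [[x hx] [y hy]] a0; split; first by nia.
have [k [E|E]] : exists k, x = 2 * k \/ x = 2 * k + 1.
  by have [k|k] := Z.Even_or_Odd x; case: k => k ?; exists k; lia.
- have [j [E'|E']] : exists k, y = 2 * k \/ y = 2 * k + 1.
    by have [j|j] := Z.Even_or_Odd y; case: j => j ?; exists j; lia.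
  + by subst x y; lia.
  + by subst x y; lia.
- have [j [E'|E']] : exists j, k = 2 * j \/ k = 2 * j + 1.
    by have [j|j] := Z.Even_or_Odd k; case: j => j ?; exists j; lia.
  + by exists (j * (2 * j + 1)); subst x k; lia.
  + by exists ((2 * j + 1) * (j + 1)); subst x k; lia.
Qed.

Lemma negative_kind_mod8 a : negative_kind a -> a < 0 /\ exists k, a = 8 * k - 1 \/ a = 8 * k - 3.
Proof.
move=> [x [_ [hx _]]]; split; first by nia.
have [k|k] := Z.Even_or_Odd x; case: k => k E; subst x.
- by exists (- (k * k)); left; lia.
- by exists (- (k * k + k)); right; lia.
Qed.

(** The product a b + 1 is negative, hence would be -2 w^2, but it is odd. *)
Lemma mixed_kinds a b : positive_kind a -> a <> 0 -> negative_kind b ->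
  ~ rational_square (a * b + 1).
Proof.
move=> ha a0 hb /rational_squareE [w hw].
have [a1 [k hk]] := positive_kind_mod8 a ha a0; have [b1 _] := negative_kind_mod8 b hb.
case: hw => hw; first by nia.
by rewrite hk in hw; lia.
Qed.

Lemma square_mod4 w : exists k, w * w = 4 * k \/ w * w = 4 * k + 1.
Proof.
have [k|k] := Z.Even_or_Odd w; case: k => k ->.
- by exists (k * k); left; lia.
- by exists (k * k + k); right; lia.
Qed.

(** Two of the three are congruent to the same -1 or -3 modulo 8, so their
    product plus 1 is a positive number congruent to 2 modulo 8. *)
Lemma three_negative_kinds a b c : negative_kind a -> negative_kind b -> negative_kind c ->
  rational_square (a * b + 1) -> rational_square (a * c + 1) -> rational_square (b * c + 1) -> False.
Proof.
have same k l r : r = 1 \/ r = 3 -> 8 * k - r < 0 -> 8 * l - r < 0 ->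
    ~ rational_square ((8 * k - r) * (8 * l - r) + 1).
  move=> hr k0 l0 /rational_squareE [w [hw|hw]]; last by nia.
  have [j hj] := square_mod4 w.
  by case: hr => E; rewrite E in hw; lia.
move=> /negative_kind_mod8 [a0 [k ha]] /negative_kind_mod8 [b0 [l hb]] /negative_kind_mod8 [c0 [m hc]].
have r1 : (1 = 1 \/ 1 = 3) by left.
have r3 : (3 = 1 \/ 3 = 3) by right.
by case: ha => ?; case: hb => ?; case: hc => ?; subst a b c => h1 h2 h3;
   first [exact: (same k l 1 r1 a0 b0 h1) | exact: (same k l 3 r3 a0 b0 h1)
   | exact: (same k m 1 r1 a0 c0 h2) | exact: (same k m 3 r3 a0 c0 h2)
   | exact: (same l m 1 r1 b0 c0 h3) | exact: (same l m 3 r3 b0 c0 h3)].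
Qed.

Lemma positive_pair a b : 0 < a -> 0 < b -> rational_square (a * b + 1) -> Zsquare (a * b + 1).
Proof. by move=> a0 b0 /rational_squareE [w [h|h]]; [exists w | nia]. Qed.

Lemma no_positive_triple a b c : 0 < a -> a < b -> b < c ->
  positive_kind a -> positive_kind b -> positive_kind c ->
  rational_square (a * b + 1) -> rational_square (a * c + 1) -> rational_square (b * c + 1) -> False.
Proof.
move=> a0 ab bc [a1 a3] [b1 b3] [c1 c3] hab hac hbc; apply: (no_quintuple a b c).
by split => //; split => //; apply: positive_pair => //; lia.
Qed.

Lemma rational_squareC a b : rational_square (a * b + 1) -> rational_square (b * a + 1).
Proof. by rewrite Z.mul_comm. Qed.

Lemma no_integer_extension a b c : a <> 0 -> b <> 0 -> c <> 0 ->
  a <> b -> a <> c -> b <> c ->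
  positive_kind a \/ negative_kind a -> positive_kind b \/ negative_kind b ->
  positive_kind c \/ negative_kind c ->
  rational_square (a * b + 1) -> rational_square (a * c + 1) -> rational_square (b * c + 1) -> False.
Proof.
move=> a0 b0 c0 ab ac bc ka kb kc hab hac hbc.
have hba := rational_squareC _ _ hab; have hca := rational_squareC _ _ hac.
have hcb := rational_squareC _ _ hbc.
case: ka kb kc => [pa|na] [pb|nb] [pc|nc];
  try by [exact: (mixed_kinds a b) | exact: (mixed_kinds b a) | exact: (mixed_kinds a c)
    | exact: (mixed_kinds c a) | exact: (mixed_kinds b c) | exact: (mixed_kinds c b)].
- have [a1 _] := positive_kind_mod8 a pa a0; have [b1 _] := positive_kind_mod8 b pb b0.
  have [c1 _] := positive_kind_mod8 c pc c0.
  have [h|h] : a < b \/ b < a by lia.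
  + have [h'|[h'|h']] : b < c \/ (a < c /\ c < b) \/ c < a by lia.
    * exact: (no_positive_triple a b c).
    * by apply: (no_positive_triple a c b) => //; lia.
    * by apply: (no_positive_triple c a b) => //; lia.
  + have [h'|[h'|h']] : a < c \/ (b < c /\ c < a) \/ c < b by lia.
    * by apply: (no_positive_triple b a c).
    * by apply: (no_positive_triple b c a) => //; lia.
    * by apply: (no_positive_triple c b a) => //; lia.
- exact: (three_negative_kinds a b c).
Qed.

End RationalReduction.

(** * Quintuples in Z[sqrt(-2)] *)

From mathcomp Require Import all_boot all_order all_algebra.
Import GRing.Theory.
Local Open Scope ring_scope.

Section Components.
Import mathcomp.zify.zify ssrZ.

Lemma three_parts : rat_part (3 : zsqrtN2) = 3 /\ irr_part (3 : zsqrtN2) = 0.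
Proof. by []. Qed.

Lemma square_parts (x y : zsqrtN2) : is_square (x * y + 1) -> exists w1 w2 : int,
  rat_part x * rat_part y - 2 * (irr_part x * irr_part y) + 1 = w1 * w1 - 2 * (w2 * w2) /\
  rat_part x * irr_part y + irr_part x * rat_part y = 2 * (w1 * w2).
Proof.
case=> w; rewrite expr2 => h; exists (rat_part w), (irr_part w); split.
- exact: (congr1 rat_part h).
- have /= := congr1 irr_part h.
  rewrite addr0 => ->; rewrite [irr_part w * _]mulrC -mulr2n mulr_natl; by [].
Qed.

Lemma extension_parts (a : zsqrtN2) : is_square (1 * a + 1) -> is_square (3 * a + 1) ->
  irr_part a = 0 /\ (positive_kind (Z_of_int (rat_part a)) \/ negative_kind (Z_of_int (rat_part a))).
Proof.
move=> /square_parts[x1 [x2 [h1 h2]]] /square_parts[y1 [y2 [h3 h4]]].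
move: h1 h2 h3 h4; have -> : rat_part 1 = 1 by []. have -> : irr_part 1 = 0 by [].
have [-> ->] := three_parts; move=> h1 h2 h3 h4.
have [] := @extension_kind (Z_of_int (rat_part a)) (Z_of_int (irr_part a))
  (Z_of_int x1) (Z_of_int x2) (Z_of_int y1) (Z_of_int y2); try lia.
by move=> h ?; split => //; lia.
Qed.

Lemma pair_parts (a b : zsqrtN2) : irr_part a = 0 -> irr_part b = 0 ->
  is_square (a * b + 1) ->
  rational_square (Z_of_int (rat_part a) * Z_of_int (rat_part b) + 1)%ZZ.
Proof.
move=> ha hb /square_parts[w1 [w2 []]]; rewrite ha hb => h1 h2.
by exists (Z_of_int w1), (Z_of_int w2); lia.
Qed.

Lemma rat_part_inj (x y : zsqrtN2) : irr_part x = 0 -> irr_part y = 0 -> x <> y ->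
  Z_of_int (rat_part x) <> Z_of_int (rat_part y).
Proof.
move=> hx hy xy h; apply: xy; case: x y hx hy h => [x1 x2] [y1 y2] /= -> -> h.
by congr ZsqrtN2; lia.
Qed.

End Components.

Theorem corollary1p2 :
  ~ exists a b c : zsqrtN2, diophantine_tuple [tuple 1; 3; a; b; c].
Proof.
move=> [a [b [c [nonzero distinct square]]]].
pose i k (h : (k < 5)%N) : 'I_5 := Ordinal h.
have sq k l hk hl : (k < l)%N -> _ := square (i k hk) (i l hl).
have ne k l hk hl : k <> l -> tnth [tuple 1; 3; a; b; c] (i k hk) <> tnth [tuple 1; 3; a; b; c] (i l hl).
  by move=> kl; apply: distinct => -[].
have [ai ka] := extension_parts a (sq 0 2 isT isT isT) (sq 1 2 isT isT isT).
have [bi kb] := extension_parts b (sq 0 3 isT isT isT) (sq 1 3 isT isT isT).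
have [ci kc] := extension_parts c (sq 0 4 isT isT isT) (sq 1 4 isT isT isT).
have a0 := rat_part_inj a 0 ai erefl (nonzero (i 2 isT)).
have b0 := rat_part_inj b 0 bi erefl (nonzero (i 3 isT)).
have c0 := rat_part_inj c 0 ci erefl (nonzero (i 4 isT)).
have ab : a <> b := ne 2 3 isT isT (fun e => ltac:(done)).
have ac : a <> c := ne 2 4 isT isT (fun e => ltac:(done)).
have bc : b <> c := ne 3 4 isT isT (fun e => ltac:(done)).
apply: (no_integer_extension _ _ _ a0 b0 c0 (rat_part_inj _ _ ai bi ab)
  (rat_part_inj _ _ ai ci ac) (rat_part_inj _ _ bi ci bc) ka kb kc).
- exact: pair_parts ai bi (sq 2 3 isT isT isT).
- exact: pair_parts ai ci (sq 2 4 isT isT isT).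
- exact: pair_parts bi ci (sq 3 4 isT isT isT).
Qed.
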